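(* Let $K$ be an abelian field of conductor $p^r$ ($p$ odd prime, $r\ge1$), $\zeta$ a primitive $p^r$-th root of unity, $e=[\mathbb{Q}(\zeta):K]$, $d=\frac{p-1}{e}$, $\mathcal{O}_K$ the ring of integers, and $q(x,y)=\mathrm{Tr}_{K/\mathbb{Q}}(x\overline{y})$, with $\overline{\cdot}$ complex conjugation. Then the lattice $(\mathcal{O}_K,q)$ is isometric to the orthogonal sum $\Gamma_K\perp\Lambda_K$, where $\Gamma_K$ is the orthogonal sum of $\frac{p^{r-1}-1}{e}$ copies of the lattice of rank $p-1$ with Gram matrix $p^{r-1}(pI_{p-1}-J_{p-1})$ (equivalently, $p^{r}A_{p-1}^{\#}$, the dual of the root lattice $A_{p-1}$ with form scaled by $p^r$), and $\Lambda_K$ is the lattice of rank $d$ with Gram matrix $ep^{r-1}\big(\tfrac{p}{e}I_d-J_d\big)$.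
   Context: A lattice is a pair $(L,q)$ with $L$ a free $\mathbb{Z}$-module of finite rank and $q$ a positive definite symmetric bilinear form on $L\otimes\mathbb{R}$. $I_m$ is the $m\times m$ identity matrix and $J_m$ the $m\times m$ all-ones matrix. For $a\in\mathbb{R}$, $a(L,q)=(L,aq)$. $K$ is totally real or totally complex, so $x\mapsto\overline{x}$ preserves $K$. *)

(* Defs.v *)
From HB Require Import structures.
From mathcomp Require Import all_boot all_order all_fingroup all_algebra.
From mathcomp Require Import all_field.
From mathcomp Require Import boolp classical_sets reals.

Set Warnings "-redundant-canonical-projection".
Set Implicit Arguments.
Unset Strict Implicit.
Unset Printing Implicit Defensive.

Import Order.TTheory GRing.Theory Num.Theory.

Local Open Scope ring_scope.

(* A Z-module with a real-valued form on it; [is_lattice] below selects the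
   lattices among these. *)
Record form_module (R : realType) := FormModule {
  fm_sort :> zmodType;
  fm_form : fm_sort -> fm_sort -> R
}.

Definition is_basis (M : zmodType) (n : nat) (b : 'I_n -> M) : Prop :=
  forall x : M, exists! c : 'rV[int]_n, x = \sum_(i < n) b i *~ c 0 i.

(* Through the basis [b], M (x) R is identified with R^n, on which the form is
   given by the Gram matrix of [b]; positive definiteness is required there, and
   not only on M. *)
Definition is_lattice (R : realType) (n : nat) (M : form_module R) : Prop :=
  [/\ forall x y z : M, fm_form (x + y) z = fm_form x z + fm_form y z,
      forall x y : M, fm_form x y = fm_form y x
    & exists2 b : 'I_n -> M, is_basis b &
        forall v : 'rV[R]_n, v != 0 ->
          0 < \sum_(i < n) \sum_(j < n) v 0 i * v 0 j * fm_form (b i) (b j)].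

Definition isometric (R : realType) (M N : form_module R) : Prop :=
  exists2 f : {additive M -> N}, bijective f &
    forall x y : M, fm_form (f x) (f y) = fm_form x y.

Definition orth_sum (R : realType) (M N : form_module R) : form_module R :=
  @FormModule R (M * N)%type
    (fun x y => fm_form x.1 y.1 + fm_form x.2 y.2).

Definition orth_copies (R : realType) (n : nat) (M : form_module R) :
    form_module R :=
  @FormModule R {ffun 'I_n -> M}
    (fun x y => \sum_(i < n) fm_form (x i) (y i)).

Definition scale_form (R : realType) (a : R) (M : form_module R) :
    form_module R :=
  @FormModule R M (fun x y => a * fm_form x y).

Definition gram_lattice (R : realType) (n : nat) (G : 'M[R]_n) :
    form_module R :=
  @FormModule R 'rV[int]_n
    (fun x y => (map_mx intr x *m G *m (map_mx intr y)^T) 0 0).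

Section Dual.
Variables (R : realType) (n : nat).
Implicit Types (S : set 'rV[R]_n) (x y : 'rV[R]_n).

Definition dotmx x y : R := (x *m y^T) 0 0.

Definition real_span S x : Prop :=
  exists (m : nat) (c : 'I_m -> R) (s : 'I_m -> 'rV[R]_n),
    (forall i, S (s i)) /\ x = \sum_(i < m) c i *: s i.

(* Dual of a lattice S of Euclidean R^n, taken in the real span of S. *)
Definition dual_pred S : {pred 'rV[R]_n} := fun x =>
  `[< real_span S x /\ forall y, S y -> dotmx x y \is a Num.int >].

Lemma dual_zmod_closed S : zmod_closed (dual_pred S).
Proof.
split=> [|x y].
  apply/asboolP; split; last by move=> y _; rewrite /dotmx mul0mx mxE.
  exists 0%N, (fun=> 0), (fun=> 0); split; first by case.
  by rewrite big_ord0.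
move=> /asboolP[[m [c [s [Ss ->]]]] Hx] /asboolP[[m' [c' [s' [Ss' ->]]]] Hy].
apply/asboolP; split; last first.
  move=> z Sz; rewrite /dotmx mulmxBl !mxE -/(dotmx _ _).
  by move: (Hx z Sz) (Hy z Sz); rewrite /dotmx !mxE; apply: rpredB.
exists (m + m')%N,
  (fun i => match split i with inl j => c j | inr j => - c' j end),
  (fun i => match split i with inl j => s j | inr j => s' j end).
split; first by move=> i; case: (split i).
rewrite big_split_ord /= -sumrN; congr (_ + _); apply: eq_bigr => i _.
  by rewrite (unsplitK (inl i : 'I_m + 'I_m')).
by rewrite (unsplitK (inr i : 'I_m + 'I_m')) scaleNr.
Qed.

Variable S : set 'rV[R]_n.

HB.instance Definition _ :=
  GRing.isZmodClosed.Build 'rV[R]_n (dual_pred S) (dual_zmod_closed S).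

Inductive dual_type : predArgType := DualElt x of x \in dual_pred S.
Definition dual_val (u : dual_type) : 'rV[R]_n := let: DualElt x _ := u in x.

HB.instance Definition _ := [isSub for dual_val].
HB.instance Definition _ := [Choice of dual_type by <:].
HB.instance Definition _ := [SubChoice_isSubZmodule of dual_type by <:].

Definition dual_lattice : form_module R :=
  @FormModule R dual_type (fun u v => dotmx (val u) (val v)).

End Dual.

Definition root_lattice_A (R : realType) (n : nat) : set 'rV[R]_n.+1 :=
  fun v => exists2 y : 'rV[int]_n.+1,
    \sum_(i < n.+1) y 0 i = 0 & v = map_mx intr y.
Arguments root_lattice_A : clear implicits.

(* A number field is a subfield K of a normal number field L, which comes with
   an embedding of L in the complex (algebraic) numbers. *)
Section NumberField.
Variables (L : splittingFieldType rat) (iota : {rmorphism L -> algC}).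
Implicit Type K : {subfield L}.

Definition abelian_field K : Prop :=
  galois 1 K /\ abelian 'Gal(K / 1)%g.

Definition sub_cyclotomic K (n : nat) : Prop :=
  exists2 w : algC, n.-primitive_root w &
    forall x : L, x \in K ->
      exists P : {poly rat}, iota x = (map_poly ratr P).[w].

Definition has_conductor K (n : nat) : Prop :=
  sub_cyclotomic K n /\ forall m : nat, sub_cyclotomic K m -> (n <= m)%N.

(* The unique map on L such that iota (conj_field x) = (iota x)^*. *)
Definition conj_field : {lrmorphism L -> L} :=
  sval (restrict_aut_to_normal_num_field iota Num.conj).

(* For K Galois over the rationals, galTrace 1 K x lies on the line 1 of L; its
   coordinate on the basis 1 is the corresponding rational number. *)
Definition trace_field K (x : L) : rat :=
  coord [tuple (1 : L)] ord0 (galTrace 1 K x).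

Definition int_pred K : {pred L} :=
  fun x => (x \in K) && (iota x \in Aint).

Lemma int_subring_closed K : subring_closed (int_pred K).
Proof.
have memE x : (x \in int_pred K) = (x \in K) && (iota x \in Aint) by [].
split=> [|x y|x y]; rewrite !memE.
- by rewrite mem1v rmorph1 rpred1.
- by move=> /andP[Kx Ax] /andP[Ky Ay]; rewrite rpredB // rmorphB rpredB.
by move=> /andP[Kx Ax] /andP[Ky Ay]; rewrite rpredM // rmorphM rpredM.
Qed.

Variable K : {subfield L}.

HB.instance Definition _ :=
  GRing.isSubringClosed.Build L (int_pred K) (int_subring_closed K).

Inductive ring_of_integers : predArgType :=
  RingOfIntegers x of x \in int_pred K.
Definition roi_val (u : ring_of_integers) : L :=
  let: RingOfIntegers x _ := u in x.

HB.instance Definition _ := [isSub for roi_val].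
HB.instance Definition _ := [Choice of ring_of_integers by <:].
HB.instance Definition _ :=
  [SubChoice_isSubComNzRing of ring_of_integers by <:].

Definition trace_lattice (R : realType) : form_module R :=
  @FormModule R ring_of_integers
    (fun x y => ratr (trace_field K (val x * conj_field (val y)))).

End NumberField.

Definition Gamma_block (R : realType) (p r : nat) : 'M[R]_(p.-1) :=
  p%:R ^+ r.-1 *: (p%:R%:M - const_mx 1).

Definition Gamma_lattice (R : realType) (p r e : nat) : form_module R :=
  orth_copies ((p ^ r.-1 - 1) %/ e) (gram_lattice (Gamma_block R p r)).

Definition Lambda_gram (R : realType) (p r e d : nat) : 'M[R]_d :=
  (e%:R * p%:R ^+ r.-1) *: ((p%:R / e%:R)%:M - const_mx 1).

Definition Lambda_lattice (R : realType) (p r e d : nat) : form_module R :=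
  gram_lattice (Lambda_gram R p r e d).

(* Main.v *)
Require Import Defs.
From HB Require Import structures.
From mathcomp Require Import all_boot all_order all_fingroup all_algebra.
From mathcomp Require Import all_solvable all_field.
From mathcomp Require Import boolp classical_sets reals.
From mathcomp Require Import ring zify.

Set Implicit Arguments.
Unset Strict Implicit.
Unset Printing Implicit Defensive.

Import Order.TTheory GRing.Theory Num.Theory.

Local Open Scope ring_scope.

(* Let E = Q(z), H = Gal(E/K), e = #|H| and n0 = p^(r-1). Minimality of the
   conductor forces e to be prime to p, hence e divides p - 1 and H acts freely,
   through its exponents on z, on the nonzero residues mod n0 and mod p. The
   relative traces T(z^j), for j = c + n0 l with c in a transversal of H on the
   nonzero residues mod n0 and l < p - 1, and for j = n0 c with c in a
   transversal of H on the nonzero residues mod p, have the announced Gram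
   matrix, because Tr(z^u / z^v) = p^r [u = v mod p^r] - n0 [u = v mod n0].
   They generate the ring of integers O of K: since the ring of integers of E is
   Z[z], each x in O has e x = T(x) in their span, and pairing e x with them
   shows that its coordinates are divisible by e. *)

(** * Lattices and orthogonal sums *)

(** Since [e] is prime to [p], E/K is tamely ramified, which is the conceptual reason why T maps
    Z[z] onto O. Neither ramification in E/K nor the discriminant of K is used: arithmetic modulo
    [e] takes their place. There p = 1, so the Gram blocks become n0 (I - J) and n0 I; as J has size
    p - 1, a multiple of e, J^2 = (p - 1) J vanishes modulo e and I - J has inverse I + J. The range
    of the exponents reflects the only relations needed: for fixed c the p numbers z^(c + n0 l), l <
    p, add up to 0, so l = p - 1 is dropped, and the p-th roots of unity add up to 0, so 1 is
    dropped. Linear independence of the traces is not proved by itself: it comes out of the positive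
    definiteness of the orthogonal sum. *)

Section Lattices.
Variable R : realType.
Implicit Types (I J : finType) (M N : form_module R).

(* [is_lattice] with the basis indexed by a finite type, so that orthogonal
   sums need no renumbering. *)
Definition lattice_on I M : Prop :=
  [/\ forall x y z : M, fm_form (x + y) z = fm_form x z + fm_form y z,
      forall x y : M, fm_form x y = fm_form y x
    & exists2 b : I -> M,
        forall x : M, exists! c : {ffun I -> int}, x = \sum_i b i *~ c i &
        forall v : {ffun I -> R}, v != 0 ->
          0 < \sum_i \sum_j v i * v j * fm_form (b i) (b j)].

Lemma lattice_on_is_lattice I n M :
  #|I| = n -> lattice_on I M -> is_lattice n M.
Proof.
move=> <- [addM symM [b basb posb]]; split=> //; exists (b \o enum_val).
  move=> x; have [c [xE cU]] := basb x.
  exists (\row_i c (enum_val i)); split=> [|c' xE'].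
    rewrite xE (reindex (fun i : 'I_#|I| => enum_val i)) /=;
      last exact: onW_bij (@enum_val_bij I).
    by apply: eq_bigr => i _; rewrite mxE.
  apply/rowP => i; rewrite mxE (cU [ffun j => c' 0 (enum_rank j)]).
    by rewrite ffunE enum_valK.
  rewrite xE' (reindex (fun i : I => enum_rank i)) /=;
    last exact: onW_bij (@enum_rank_bij I).
  by apply: eq_bigr => j _; rewrite /= enum_rankK ffunE.
move=> v v_neq0; pose w : {ffun I -> R} := [ffun i => v 0 (enum_rank i)].
have /posb : w != 0.
  apply: contra_neq v_neq0 => /ffunP w0; apply/rowP => i; rewrite mxE.
  by have := w0 (enum_val i); rewrite !ffunE enum_valK.
congr (0 < _); rewrite (reindex (fun i : 'I_#|I| => enum_val i)) /=.
  apply: eq_bigr => i _; rewrite (reindex (fun i : 'I_#|I| => enum_val i)) /=.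
    by apply: eq_bigr => j _; rewrite !ffunE !enum_valK.
  exact: onW_bij (@enum_val_bij I).
exact: onW_bij (@enum_val_bij I).
Qed.

Section Forms.
Variables (M : form_module R).
Hypothesis addM :
  forall x y z : M, fm_form (x + y) z = fm_form x z + fm_form y z.
Hypothesis symM : forall x y : M, fm_form x y = fm_form y x.

Lemma fm_form0l (y : M) : fm_form 0 y = 0.
Proof. by apply: (addrI (fm_form 0 y)); rewrite -addM !addr0. Qed.

Lemma fm_form_sumzl I (b : I -> M) (c : I -> int) (y : M) :
  fm_form (\sum_i b i *~ c i) y = \sum_i (c i)%:~R * fm_form (b i) y.
Proof.
have formN (x : M) : fm_form (- x) y = - fm_form x y.
  by apply: (addrI (fm_form x y)); rewrite -addM !subrr fm_form0l.
have formMn (x : M) n : fm_form (x *+ n) y = n%:R * fm_form x y.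
  elim: n => [|n IHn]; first by rewrite mulr0n mul0r fm_form0l.
  by rewrite mulrSr addM IHn -natr1 mulrDl mul1r.
have formMz (x : M) m : fm_form (x *~ m) y = m%:~R * fm_form x y.
  case: m => n; first by rewrite -pmulrn formMn.
  by rewrite NegzE mulrNz formN -pmulrn formMn mulrNz mulNr.
elim/big_ind2: _ => [|x1 a1 x2 a2 <- <-|i _] //; first exact: fm_form0l.
Qed.

Lemma fm_form_sumz I (b : I -> M) (c c' : I -> int) :
  fm_form (\sum_i b i *~ c i) (\sum_i b i *~ c' i) =
  \sum_i \sum_j (c i)%:~R * (c' j)%:~R * fm_form (b i) (b j).
Proof.
rewrite fm_form_sumzl; apply: eq_bigr => i _.
rewrite symM fm_form_sumzl mulr_sumr; apply: eq_bigr => j _.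
by rewrite symM mulrA.
Qed.

End Forms.

(** This is what makes an additive form-preserving map out of a lattice injective. *)
Lemma lattice_on_form_gt0 I M : lattice_on I M ->
  forall x : M, x != 0 -> 0 < fm_form x x.
Proof.
move=> [addM symM [b basb posb]] x x_neq0.
have [c [xE _]] := basb x.
have := posb [ffun i => (c i)%:~R]; rewrite {2}xE {1}xE fm_form_sumz //.
have /[swap]/[apply] : [ffun i => (c i)%:~R] != 0 :> {ffun I -> R}.
  apply: contra_neq x_neq0 => /ffunP c0; rewrite xE big1 // => i _.
  by have := c0 i; rewrite !ffunE => /eqP; rewrite intr_eq0 => /eqP->.
congr (0 < _); apply: eq_bigr => i _; apply: eq_bigr => j _.
by rewrite !ffunE.
Qed.

(** Through this transport the trace form becomes a lattice, with its rank, as soon as the isometry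
    with the explicit orthogonal sum is known. *)
Lemma isometric_lattice_on I M N :
  isometric M N -> lattice_on I N -> lattice_on I M.
Proof.
move=> [f [g fK gK] fP] [addN symN [b basb posb]].
split=> [x y w|x y|]; rewrite -?fP ?raddfD //.
have gE (c : I -> int) : f (\sum_i g (b i) *~ c i) = \sum_i b i *~ c i.
  by rewrite raddf_sum; apply: eq_bigr => i _; rewrite raddfMz gK.
exists (g \o b) => [x|v /posb]; last first.
  by congr (0 < _); apply: eq_bigr => i _; apply: eq_bigr => j _;
    rewrite -fP /= !gK.
have [c [xE cU]] := basb (f x); exists c; split=> [|c' xE'].
  by apply: (can_inj fK); rewrite gE.
by apply: cU; rewrite -gE -xE'.
Qed.

Lemma isometric_sym M N : isometric M N -> isometric N M.
Proof.
move=> [f [g fK gK] fP].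
have gB : zmod_morphism g by move=> x y; apply: (can_inj fK);
  rewrite raddfB !gK.
pose G : {additive N -> M} := HB.pack g (GRing.isZmodMorphism.Build _ _ g gB).
by exists G => [|x y]; [exists f | rewrite -fP /= !gK].
Qed.

(** Cauchy-Schwarz against the all-ones vector; twice the difference of the two sides is the sum of
    all (v_i - v_j)^2. *)
Lemma sum_sqr_le n (v : 'I_n -> R) :
  (\sum_i v i) ^+ 2 <= n%:R * \sum_i v i ^+ 2.
Proof.
rewrite -subr_ge0 -(pmulr_rge0 _ (ltr0n R 2)).
rewrite [leRHS](_ : _ = \sum_i \sum_j (v i - v j) ^+ 2).
  by apply: sumr_ge0 => i _; apply: sumr_ge0 => j _; apply: sqr_ge0.
transitivity (\sum_i \sum_j (v i ^+ 2 + v j ^+ 2 - 2 * (v i * v j))).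
  transitivity (\sum_i (n%:R * v i ^+ 2 + \sum_j v j ^+ 2 - 2 * (v i * \sum_j v
    j))).
    rewrite sumrB big_split /= sumr_const card_ord -!mulr_sumr -mulr_suml.
    by rewrite -[X in _ + X - _]mulr_natl; ring.
  apply: eq_bigr => i _; rewrite sumrB big_split /= sumr_const card_ord.
  by rewrite -!mulr_sumr -[_ ^+ 2 *+ n]mulr_natl.
by apply: eq_bigr => i _; apply: eq_bigr => j _; ring.
Qed.

Lemma gram_lattice_form n (G : 'M[R]_n) (x y : gram_lattice G) :
  fm_form x y = \sum_i \sum_j (x 0 i)%:~R * (y 0 j)%:~R * G i j.
Proof.
rewrite /= mxE exchange_big; apply: eq_bigr => j _.
by rewrite mxE mulr_suml; apply: eq_bigr => i _; rewrite !mxE; ring.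
Qed.

(** The quadratic form is s (t |v|^2 - (sum of v)^2), positive by Cauchy-Schwarz because n < t. Both
    blocks have this shape: t = p in rank p - 1, and t = p / e in rank d = (p - 1) / e. *)
Lemma gram_lattice_on n (s t : R) : 0 < s -> n%:R < t ->
  lattice_on 'I_n (gram_lattice (s *: (t%:M - const_mx 1) : 'M_n)).
Proof.
move=> s_gt0 t_gtn; set G := _ *: _.
have Gsym i j : G i j = G j i by rewrite !mxE eq_sym.
have sumE (c : 'I_n -> int) :
    \sum_i delta_mx 0 i *~ c i = \row_i c i :> 'rV[int]_n.
  apply/rowP => i; rewrite summxE (bigD1 i) //= big1 ?addr0 => [|j nij].
    by rewrite -scaler_int !mxE !eqxx mulr1 intz.
  by rewrite -scaler_int !mxE !eqxx eq_sym (negPf nij) mulr0.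
split=> [x y w|x y|].
- by rewrite /= map_mxD !mulmxDl mxE.
- rewrite !gram_lattice_form exchange_big; apply: eq_bigr => i _.
  by apply: eq_bigr => j _; rewrite Gsym; ring.
exists (fun i => delta_mx 0 i) => [x|v v_neq0].
  exists [ffun i => x 0 i]; split=> [|c ->].
    rewrite sumE; apply/rowP => i; rewrite mxE; exact/esym/ffunE.
  by apply/ffunP => i; rewrite ffunE sumE mxE.
have -> : \sum_i \sum_j v i * v j * fm_form (delta_mx 0 i : gram_lattice G)
      (delta_mx 0 j) = s * (t * (\sum_i v i ^+ 2) - (\sum_i v i) ^+ 2).
  transitivity (\sum_i \sum_j v i * v j * G i j).
    apply: eq_bigr => i _; apply: eq_bigr => j _; congr (_ * _).
    rewrite gram_lattice_form (bigD1 i) //= [X in _ + X]big1 ?addr0 => [|k nki].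
      rewrite (bigD1 j) //= big1 ?addr0 => [|l nlj];
        rewrite !mxE !eqxx ?mul1r //.
      by rewrite (negPf nlj) /= mulr0z ?mulr0 mul0r.
    by apply: big1 => l _; rewrite !mxE !eqxx (negPf nki) /= mulr0z !mul0r.
  rewrite mulrBr mulr_sumr mulr_sumr expr2 mulr_suml mulr_sumr -sumrB.
  apply: eq_bigr => i _; rewrite mulr_sumr mulr_sumr.
  rewrite (bigD1 i) //= [X in _ = _ - X](bigD1 i) //= opprD addrA -sumrN.
  congr (_ + _); first by rewrite !mxE eqxx mulr1n; ring.
  by apply: eq_bigr => j nji; rewrite !mxE eq_sym (negPf nji) mulr0n; ring.
apply: mulr_gt0 => //; rewrite subr_gt0.
apply: le_lt_trans (sum_sqr_le v) _; rewrite ltr_pM2r //.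
rewrite lt_def sumr_ge0 ?andbT => [|i _]; last exact: sqr_ge0.
apply: contra_neq v_neq0 => /psumr_eq0P v0; apply/ffunP => i; rewrite ffunE.
by apply/eqP; rewrite -sqrf_eq0 v0 // => j _; apply: sqr_ge0.
Qed.

Lemma orth_sum_lattice_on I J M N :
  lattice_on I M -> lattice_on J N -> lattice_on (I + J)%type (orth_sum M N).
Proof.
move=> [addM symM [b basb posb]] [addN symN [b' basb' posb']].
split=> [x y w|x y|]; first by rewrite /= addM addN addrACA.
  by rewrite /= symM symN.
pose B (k : I + J) : orth_sum M N :=
  match k with inl i => (b i, 0) | inr j => (0, b' j) end.
have sumE (c : I + J -> int) : \sum_k B k *~ c k =
    (\sum_i b i *~ c (inl i), \sum_j b' j *~ c (inr j)).
  rewrite big_sumType /=; apply: injective_projections.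
    by rewrite raddfD !raddf_sum -[RHS]addr0; congr (_ + _);
      [|rewrite big1]; move=> *; rewrite ?raddfMz ?mul0rz //;
      apply: eq_bigr => i _; rewrite raddfMz.
  by rewrite raddfD !raddf_sum -[RHS]add0r; congr (_ + _);
    [rewrite big1|]; move=> *; rewrite ?raddfMz ?mul0rz //;
    apply: eq_bigr => i _; rewrite raddfMz.
exists B => [[x y]|v v_neq0].
  have [c [xE cU]] := basb x; have [c' [yE cU']] := basb' y.
  exists [ffun k => match k with inl i => c i | inr j => c' j end].
  split=> [|w]; rewrite sumE.
    by rewrite [in LHS]xE [in LHS]yE; congr (_, _); apply: eq_bigr => i _;
      rewrite ffunE.
  case=> xE' yE'; apply/ffunP => -[i|j]; rewrite ffunE.
    rewrite (cU [ffun i => w (inl i)]) ?ffunE // xE'.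
    by apply: eq_bigr => k _; rewrite ffunE.
  rewrite (cU' [ffun i => w (inr i)]) ?ffunE // yE'.
  by apply: eq_bigr => k _; rewrite ffunE.
pose u : {ffun I -> R} := [ffun i => v (inl i)].
pose u' : {ffun J -> R} := [ffun i => v (inr i)].
have -> : \sum_i \sum_j v i * v j * fm_form (B i) (B j) =
    \sum_i \sum_j u i * u j * fm_form (b i) (b j) +
    \sum_i \sum_j u' i * u' j * fm_form (b' i) (b' j).
  rewrite big_sumType /=; congr (_ + _); apply: eq_bigr => i _;
    rewrite big_sumType /=.
    rewrite [X in _ + X]big1 => [|j _]; last first.
      by rewrite (fm_form0l addN) symM (fm_form0l addM) addr0 mulr0.
    by rewrite addr0; apply: eq_bigr => j _;
      rewrite !ffunE (fm_form0l addN) addr0.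
  rewrite big1 ?add0r => [|j _]; last first.
    by rewrite symN (fm_form0l addN) (fm_form0l addM) addr0 mulr0.
  by apply: eq_bigr => j _; rewrite !ffunE (fm_form0l addM) add0r.
(* A nonzero vector of the sum may vanish in one component, so each half is only nonnegative in
   general; the case split on [u] finds a positive one. *)
have ge0 (T : finType) (P : form_module R) (h : T -> P) (w : {ffun T -> R}) :
    (w != 0 -> 0 < \sum_i \sum_j w i * w j * fm_form (h i) (h j)) ->
  0 <= \sum_i \sum_j w i * w j * fm_form (h i) (h j).
  have [-> _|_ /(_ isT)/ltW//] := eqVneq w 0.
  by rewrite big1 // => i _; rewrite big1 // => j _; rewrite !ffunE !mul0r.
have [u0|u_neq0] := eqVneq u 0; last by rewrite ltr_pwDl ?posb ?ge0 //;
  apply: posb'.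
rewrite ltr_wpDl ?posb' ?ge0 //; first exact: posb.
apply: contra_neq v_neq0 => u'0; apply/ffunP => -[i|i]; rewrite ffunE.
  by move/ffunP/(_ i): u0; rewrite !ffunE.
by move/ffunP/(_ i): u'0; rewrite !ffunE.
Qed.

Lemma orth_copies_lattice_on I n M :
  lattice_on I M -> lattice_on ('I_n * I)%type (orth_copies n M).
Proof.
move=> [addM symM [b basb posb]]; split=> [x y w|x y|].
- by rewrite /= -big_split; apply: eq_bigr => i _; rewrite ffunE addM.
- by rewrite /=; apply: eq_bigr => i _; rewrite symM.
pose B (k : 'I_n * I) : orth_copies n M := [ffun i => if i == k.1 then b k.2
  else 0].
have sumE (c : 'I_n * I -> int) i :
    (\sum_k B k *~ c k : {ffun 'I_n -> M}) i = \sum_j b j *~ c (i, j).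
  rewrite sum_ffunE.
  transitivity (\sum_i' \sum_j if i == i' then b j *~ c (i', j) else 0).
    rewrite pair_bigA; apply: eq_bigr => -[i' j] _ /=.
    by rewrite ffunMzE ffunE /=; case: ifP => // _; rewrite mul0rz.
  rewrite (bigD1 i) //= eqxx [X in _ + X]big1 ?addr0 // => k nki.
  by rewrite big1 // => j _; rewrite eq_sym (negPf nki).
exists B => [x|v v_neq0].
  have /fin_all_exists[c /all_and2[xE cU]] i := basb (x i).
  exists [ffun k => c k.1 k.2]; split=> [|c' xE'].
    apply/ffunP => i; rewrite sumE {1}xE; apply: eq_bigr => j _;
      by rewrite ffunE.
  apply/ffunP => -[i j];
    rewrite ffunE /= (cU _ [ffun j => c' (i, j)]) ?ffunE //.
  by rewrite xE' sumE; apply: eq_bigr => k _; rewrite ffunE.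
pose u i : {ffun I -> R} := [ffun j => v (i, j)].
have -> : \sum_i \sum_j v i * v j * fm_form (B i) (B j) =
    \sum_i \sum_j \sum_k u i j * u i k * fm_form (b j) (b k).
  rewrite [RHS]pair_bigA; apply: eq_bigr => -[i j] _ /=.
  transitivity (\sum_i' \sum_k
      v (i, j) * v (i', k) * fm_form (B (i, j)) (B (i', k))).
    by rewrite pair_bigA; apply: eq_bigr => -[i' k].
  rewrite /= (bigD1 i) //= [X in _ + X]big1 ?addr0 => [|i' nii'].
    apply: eq_bigr => k _; rewrite !ffunE; congr (_ * _).
    rewrite (bigD1 i) //= !ffunE eqxx big1 ?addr0 // => l nli.
    by rewrite !ffunE /= (negPf nli) (fm_form0l addM).
  rewrite big1 // => k _; rewrite big1 ?mulr0 // => l _; rewrite !ffunE /=.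
  case: eqP => [->|_]; last exact: fm_form0l.
  by rewrite eq_sym (negPf nii') symM fm_form0l.
have [i ui] : exists i, u i != 0.
  apply/existsP; apply: contraNT v_neq0 => /existsPn u0;
    apply/eqP/ffunP => -[i j].
  by move/eqP/ffunP/(_ j): (negbNE (u0 i)); rewrite !ffunE.
rewrite (bigD1 i) //= ltr_pwDl ?posb // sumr_ge0 // => k _.
have [->|/posb/ltW//] := eqVneq (u k) 0.
by rewrite big1 // => l _; rewrite big1 // => m _; rewrite !ffunE !mul0r.
Qed.

End Lattices.

(** * The dual of the root lattice *)

Section DualA.
Variables (R : realType) (n : nat).

Lemma root_lattice_A_simple (i : 'I_n) :
  root_lattice_A R n (delta_mx 0 (lift ord0 i) - delta_mx 0 ord0).
Proof.
exists (delta_mx 0 (lift ord0 i) - delta_mx 0 ord0).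
  have sum_delta (k : 'I_n.+1) : \sum_j (delta_mx 0 k : 'rV[int]_n.+1) 0 j = 1.
    rewrite (bigD1 k) //= big1 ?addr0 => [|j njk]; rewrite mxE eqxx ?eqxx //.
    by rewrite (negPf njk).
  rewrite -[RHS](subrr 1) -{1}(sum_delta (lift ord0 i)) -(sum_delta ord0)
    -sumrB.
  by apply: eq_bigr => j _; rewrite [LHS]mxE; congr (_ + _); rewrite mxE.
by rewrite map_mxB !map_delta_mx.
Qed.

(** The real span of the root lattice is the hyperplane of coordinate sum 0, and integrality need
    only be tested on the vectors e_i - e_0, which generate the lattice. *)
Lemma dual_root_lattice_AP (x : 'rV[R]_n.+1) :
  reflect (\sum_j x 0 j = 0 /\
           forall i, x 0 (lift ord0 i) - x 0 ord0 \is a Num.int)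
          (x \in dual_pred (root_lattice_A R n)).
Proof.
apply: (iffP idP) => [/asboolP[[m [c [v [vA ->]]]] xint]|[x0 xint]].
  split=> [|i].
    under eq_bigr do rewrite summxE; rewrite exchange_big big1 // => i _.
    have [y y0 ->] := vA i.
    under eq_bigr do rewrite !mxE.
    by rewrite -mulr_sumr -raddf_sum y0 raddf0 mulr0.
  have := xint _ (root_lattice_A_simple i).
  by rewrite /Defs.dotmx linearB /= mulmxBr !trmx_delta -!colE !mxE.
apply/asboolP; split=> [|_ [y y0 ->]].
  exists n, (fun i => x 0 (lift ord0 i)), (fun i => delta_mx 0 (lift ord0 i) -
    delta_mx 0 ord0).
  split=> [i|]; first exact: root_lattice_A_simple.
  under eq_bigr do rewrite scalerBr.
  rewrite sumrB -scaler_suml [LHS]row_sum_delta big_ord_recl addrC;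
    congr (_ + _).
  rewrite -scaleNr; congr (_ *: _); apply/eqP; rewrite -addr_eq0.
  by move/eqP: x0; rewrite big_ord_recl.
(* As [y] has sum 0, x_0 may be subtracted from every coordinate of [x]. *)
have -> : Defs.dotmx x (map_mx intr y) = \sum_i (x 0 (lift ord0 i) - x 0 ord0)
  * (y 0 (lift ord0 i))%:~R.
  transitivity (\sum_j (x 0 j - x 0 ord0) * (y 0 j)%:~R).
    rewrite /Defs.dotmx mxE; under [RHS]eq_bigr do rewrite mulrBl.
    rewrite sumrB -mulr_sumr -raddf_sum y0 raddf0 mulr0 subr0.
    by apply: eq_bigr => j _; rewrite !mxE.
  by rewrite big_ord_recl subrr mul0r add0r.
by apply: rpred_sum => i _; rewrite rpredM // ?xint // intr_int.
Qed.

(** The dual has as basis the orthogonal projections of e_1, ..., e_n to the hyperplane of sum 0,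
    with products delta_ij - 1/(n+1). So [fv] projects (0, x_1, ..., x_n), and the inverse [g] reads
    off differences with coordinate 0. *)
Lemma gram_isometric_dual_A (s : R) :
  isometric (gram_lattice (s *: (n.+1%:R%:M - const_mx 1) : 'M_n))
    (scale_form (s * n.+1%:R) (dual_lattice (root_lattice_A R n))).
Proof.
set G := _ *: _; set D := scale_form _ _.
have n1_neq0 : n.+1%:R != 0 :> R by rewrite pnatr_eq0.
pose S (x : 'rV[int]_n) : R := \sum_i (x 0 i)%:~R.
pose fv (x : 'rV[int]_n) : 'rV[R]_n.+1 :=
  \row_j (oapp (fun i => (x 0 i)%:~R) 0 (unlift ord0 j) - S x / n.+1%:R).
have fv0 x : fv x 0 ord0 = - (S x / n.+1%:R) by rewrite mxE unlift_none add0r.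
have fvS x i : fv x 0 (lift ord0 i) = (x 0 i)%:~R - S x / n.+1%:R.
  by rewrite mxE liftK.
have fvD x : fv x \in dual_pred (root_lattice_A R n).
  apply/dual_root_lattice_AP; split=> [|i].
    rewrite big_ord_recl fv0; under eq_bigr do rewrite fvS.
    rewrite sumrB sumr_const card_ord -/(S x) -[_ *+ n]mulr_natl -natr1.
    by field; rewrite natr1.
  by rewrite fv0 fvS opprK subrK intr_int.
pose f (x : gram_lattice G) : D := DualElt (fvD x).
have SB x y : S (x - y) = S x - S y.
  by rewrite /S -sumrB; apply: eq_bigr => i _; rewrite !mxE rmorphB.
have fB : zmod_morphism f.
  move=> x y; apply: val_inj; rewrite raddfB /=; apply/rowP => j.
  rewrite !mxE SB; case: unliftP => [i _|_] /=; last by ring.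
  by rewrite !mxE rmorphB /=; ring.
pose F : {additive gram_lattice G -> D} :=
  HB.pack f (GRing.isZmodMorphism.Build _ _ f fB).
pose g (w : D) : gram_lattice G :=
  \row_i Num.floor (val w 0 (lift ord0 i) - val w 0 ord0).
exists F => [|x y].
  exists g => [x|w].
    apply/rowP => i; rewrite mxE /= fv0 fvS opprK subrK.
    exact: intrKfloor.
  apply: val_inj => /=; have /dual_root_lattice_AP[w0 wint] := valP w.
  have gE i : (g w 0 i)%:~R = val w 0 (lift ord0 i) - val w 0 ord0.
    by rewrite mxE floorK.
  have SE : S (g w) / n.+1%:R = - val w 0 ord0.
    apply: (mulIf n1_neq0); rewrite divfK // /S; under eq_bigr do rewrite gE.
    rewrite sumrB sumr_const card_ord -[_ *+ n]mulr_natl.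
    move/eqP: w0; rewrite big_ord_recl addrC addr_eq0 => /eqP->.
    by rewrite -natr1; ring.
  apply/rowP => j; rewrite mxE SE opprK.
  by case: unliftP => [i ->|->] /=; rewrite ?gE ?subrK ?add0r.
rewrite gram_lattice_form /= /Defs.dotmx mxE big_ord_recl !mxE unlift_none /=.
have -> : \sum_i \sum_j (x 0 i)%:~R * (y 0 j)%:~R * G i j =
    s * (n.+1%:R * (\sum_i (x 0 i)%:~R * (y 0 i)%:~R) - S x * S y).
  rewrite mulrBr mulr_sumr mulr_sumr /S mulr_suml mulr_sumr -sumrB.
  apply: eq_bigr => i _; rewrite mulr_sumr mulr_sumr.
  rewrite (bigD1 i) //= [X in _ = _ - X](bigD1 i) //= opprD addrA -sumrN.
  congr (_ + _); first by rewrite !mxE eqxx mulr1n; ring.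
  by apply: eq_bigr => j nji; rewrite !mxE eq_sym (negPf nji) mulr0n; ring.
have -> : \sum_(i < n) fv x 0 (lift ord0 i) * (fv y)^T (lift ord0 i) 0 =
    \sum_i (x 0 i)%:~R * (y 0 i)%:~R - S x * (S y / n.+1%:R)
    - S x / n.+1%:R * S y + n%:R * (S x / n.+1%:R * (S y / n.+1%:R)).
  transitivity (\sum_i ((x 0 i)%:~R * (y 0 i)%:~R - (x 0 i)%:~R * (S y /
    n.+1%:R)
      - S x / n.+1%:R * (y 0 i)%:~R + S x / n.+1%:R * (S y / n.+1%:R))).
    by apply: eq_bigr => i _; rewrite [(fv y)^T _ _]mxE !fvS; ring.
  rewrite big_split /= !sumrB sumr_const card_ord -mulr_suml -mulr_sumr.
  by rewrite -/(S x) -/(S y) mulr_natl.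
by rewrite -natr1; field; rewrite natr1.
Qed.

End DualA.

(** * Congruences and roots of unity *)

Lemma big_ord_dvdn (T : Type) (idx : T) (op : Monoid.com_law idx) (p m : nat)
    (F : nat -> T) : (0 < p)%N ->
  \big[op/idx]_(u < (p * m)%N | (p %| u)%N) F u = \big[op/idx]_(v < m) F (p *
    v)%N.
Proof.
move=> p_gt0.
have lt_mul (v : 'I_m) : (p * v < p * m)%N by rewrite ltn_pmul2l.
have lt_div (u : 'I_(p * m)) : (u %/ p < m)%N.
  by rewrite ltn_divLR // [(m * p)%N]mulnC.
rewrite (reindex_onto (fun v => Ordinal (lt_mul v)) (fun u => Ordinal (lt_div
  u))) /=.
  apply: eq_bigl => v; rewrite dvdn_mulr //=; apply/eqP/val_inj.
  by rewrite /= mulKn.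
by move=> u pu; apply: val_inj; rewrite /= mulnC divnK.
Qed.

Section Arithmetic.
Local Open Scope nat_scope.

Lemma geometric_sum_mod (p a n : nat) : a = 1 %[mod p] ->
  \sum_(i < n) a ^ i = n %[mod p].
Proof.
move=> a1; elim: n => [|n IHn]; first by rewrite big_ord0.
rewrite big_ord_recr /= -modnDm IHn -(modnXm n) a1 modnXm exp1n modnDm.
by rewrite addn1.
Qed.

(** With a = 1 + b p the sum is p + b p (p (p - 1) / 2) modulo p^2, and for odd p the second term
    vanishes. Hence (a^p - 1) / (a - 1) contains exactly one factor p. *)
Lemma geometric_sum_mod_sqr (p a : nat) : odd p -> a = 1 %[mod p] -> 0 < a ->
  \sum_(i < p) a ^ i = p %[mod p ^ 2].
Proof.
move=> p_odd a1 a_gt0.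
have [b ->] : exists b, a = b * p + 1.
  have /dvdnP[b Db] : p %| a - 1 by rewrite -eqn_mod_dvd //; apply/eqP.
  by exists b; rewrite -Db subnK.
have powE i : (b * p + 1) ^ i = i * (b * p) + 1 %[mod p ^ 2].
  elim: i => [|i IHi]; first by rewrite mul0n.
  rewrite expnS -modnMmr IHi modnMmr.
  rewrite (_ : _ * _ = i * b ^ 2 * p ^ 2 + (i.+1 * (b * p) + 1)); last by nia.
  by rewrite modnMDl.
have sumE n : \sum_(i < n) (b * p + 1) ^ i
    = (\sum_(0 <= i < n) i) * (b * p) + n %[mod p ^ 2].
  elim: n => [|n IHn]; first by rewrite big_ord0 big_geq.
  rewrite big_ord_recr /= -modnDm IHn powE modnDm big_nat_recr //=.
  by congr (_ %% _); nia.
rewrite sumE bin2_sum bin2odd //.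
rewrite (_ : _ + p = p.-1./2 * b * p ^ 2 + p); last by nia.
by rewrite modnMDl.
Qed.

(** The cofactor (a^e - 1) / (a - 1) is e modulo p, hence prime to p: all factors p of a^e - 1 are
    in a - 1. *)
Lemma eq1_mod_of_expn (p r e a : nat) : prime p -> 0 < a -> coprime e p ->
  a = 1 %[mod p] -> a ^ e = 1 %[mod p ^ r] -> a = 1 %[mod p ^ r].
Proof.
move=> p_pr a_gt0 cop a1 ae1; apply/eqP; rewrite eqn_mod_dvd //.
have : p ^ r %| a ^ e - 1 by rewrite -eqn_mod_dvd ?expn_gt0 ?a_gt0 //;
  apply/eqP.
rewrite !subn1 predn_exp Gauss_dvdl // coprimeXl //.
by rewrite -coprime_modr geometric_sum_mod // coprime_modr coprime_sym.
Qed.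

Lemma eq1_mod_prime_of_expn (p r a : nat) : prime p -> 0 < a ->
  a ^ p = 1 %[mod p ^ r.+1] -> a = 1 %[mod p].
Proof.
move=> p_pr a_gt0 ap1; have p_gt0 := prime_gt0 p_pr.
have ap1' : a ^ p = 1 %[mod p].
  apply/eqP; rewrite eqn_mod_dvd ?expn_gt0 ?a_gt0 //.
  apply: (@dvdn_trans (p ^ r.+1)); first by rewrite expnS dvdn_mulr.
  by rewrite -eqn_mod_dvd ?expn_gt0 ?a_gt0 //; apply/eqP.
have cop : coprime a p.
  rewrite -(coprime_pexpl _ _ p_gt0) -coprime_modl ap1' coprime_modl.
  exact: coprime1n.
have := Euler_exp_totient cop; rewrite totient_prime // => ap.
have apE : a ^ p = a * a ^ p.-1 by rewrite -expnS prednK.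
by rewrite -ap1' apE -modnMmr ap modnMmr muln1.
Qed.

(** The cofactor of a - 1 in a^p - 1 has p-adic valuation 1, so exactly one power of p is lost. *)
Lemma eq1_mod_of_expn_prime (p r a : nat) : prime p -> odd p -> 0 < a ->
  a ^ p = 1 %[mod p ^ r.+1] -> a = 1 %[mod p ^ r].
Proof.
move=> p_pr p_odd a_gt0 ap1; have p_gt0 := prime_gt0 p_pr.
have a1 := eq1_mod_prime_of_expn p_pr a_gt0 ap1.
apply/eqP; rewrite eqn_mod_dvd //.
have : p ^ r.+1 %| a ^ p - 1.
  by rewrite -eqn_mod_dvd ?expn_gt0 ?a_gt0 //; apply/eqP.
have /dvdnP[s Ds] : p %| \sum_(i < p) a ^ i.
  by rewrite /dvdn geometric_sum_mod // modnn.
rewrite !subn1 predn_exp Ds mulnA expnSr dvdn_pmul2r // Gauss_dvdl //.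
rewrite coprimeXl // prime_coprime //; apply/negP => /dvdnP[s' Ds'].
have := geometric_sum_mod_sqr p_odd a1 a_gt0.
rewrite Ds Ds' -mulnA mulnn modnMl modn_small; last first.
  by rewrite -{1}[p]expn1 ltn_exp2l // prime_gt1.
by move=> p0; rewrite -p0 in p_gt0.
Qed.

End Arithmetic.

Lemma dvdzBr d m n : (d %| n)%Z -> (d %| m - n)%Z = (d %| m)%Z.
Proof. by move=> dn; apply: rpredBr. Qed.

Lemma dvdzDl d m n : (d %| m)%Z -> (d %| m + n)%Z = (d %| n)%Z.
Proof. by move=> dm; apply: rpredDl. Qed.

Section PrimitiveRoots.
Variables (F : fieldType) (n : nat) (w : F).
Hypothesis prim_w : n.-primitive_root w.

Lemma sum_prim_root_expr j :
  \sum_(i < n) (w ^+ j) ^+ i = if (n %| j)%N then n%:R else 0.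
Proof.
case: ifPn => [|nj].
  rewrite (prim_order_dvd prim_w) => /eqP->.
  by under eq_bigr do rewrite expr1n; rewrite sumr_const card_ord.
have wj1 : w ^+ j - 1 != 0 by rewrite subr_eq0 -(prim_order_dvd prim_w).
apply: (mulfI wj1); rewrite mulr0 -subrX1 exprAC.
by rewrite (prim_expr_order prim_w) expr1n subrr.
Qed.

Lemma prod_1_sub_prim_root : \prod_(1 <= i < n) (1 - w ^+ i) = n%:R.
Proof.
have n_gt0 := prim_order_gt0 prim_w.
have := factor_Xn_sub_1 prim_w; rewrite big_ltn // expr0 subrX1.
have X1_neq0 : 'X - 1%:P != 0 :> {poly F} by rewrite polyXsubC_eq0.
move/(mulfI X1_neq0)/(congr1 (horner^~ 1)); rewrite horner_prod horner_sum.
under eq_bigr do rewrite hornerXsubC.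
by move=> ->; under eq_bigr do rewrite hornerXn expr1n;
  rewrite sumr_const card_ord.
Qed.

End PrimitiveRoots.

(** * Traces in number fields *)

Section NumberFields.
Variables (L : splittingFieldType rat) (iota : {rmorphism L -> algC}).

Lemma Aint_gal (K : {subfield L}) (s : gal_of K) x :
  iota x \in Aint -> iota (s x) \in Aint.
Proof.
have [nu nuE] := extend_algC_subfield_aut iota s.
by rewrite nuE Aint_aut.
Qed.

Lemma Aint_galTrace (U V : {subfield L}) x :
  iota x \in Aint -> iota (galTrace U V x) \in Aint.
Proof.
by move=> Ax; rewrite rmorph_sum rpred_sum // => s _; apply: Aint_gal.
Qed.

Lemma mem1_Aint_int x : x \in 1%VS -> iota x \in Aint -> exists m : int, x =
  m%:~R.
Proof.
move=> /vlineP[a ->]; rewrite alg_num_field fmorph_rat => Aa.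
have /intrP[m am] := Cint_rat_Aint (Crat_rat a) Aa.
by exists m; apply: (fmorph_inj iota); rewrite fmorph_rat am rmorph_int.
Qed.

Lemma galTrace_Aint_int (K : {subfield L}) x : galois 1 K -> x \in K ->
  iota x \in Aint -> exists m : int, galTrace 1 K x = m%:~R.
Proof.
by move=> galK Kx Ax; apply: mem1_Aint_int;
  [exact: mem_galTrace|exact: Aint_galTrace].
Qed.

Lemma mem_gal1 (K : {subfield L}) (s : gal_of K) : s \in 'Gal(K / 1)%g.
Proof.
rewrite gal_kHom ?sub1v //; apply/kAHomP => _ /vlineP[a ->].
by rewrite linearZ rmorph1.
Qed.

Lemma trace_fieldP (K : {subfield L}) x a :
  galTrace 1 K x = a%:A -> trace_field K x = a.
Proof.
rewrite /trace_field => ->; have free1 : free [tuple (1 : L)].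
  by rewrite /= seq1_free oner_eq0.
have /= := coord_free (ord0 : 'I_1) (ord0 : 'I_1) free1.
by rewrite linearZ /= => ->; apply: mulr1.
Qed.

(** Transitivity of the trace: Gal(E/1) is split into the fibres of restriction to K, which are
    cosets of Gal(E/K). *)
Lemma galTrace_trans (K E : {subfield L}) y :
  galois 1 E -> galois 1 K -> (K <= E)%VS -> y \in E ->
  galTrace 1 K (galTrace K E y) = galTrace 1 E y.
Proof.
move=> galE galK sKE Ey; have [_ _ nK] := and3P galK.
have s1KE : (1 <= K <= E)%VS by rewrite sub1v.
have galKE : galois K E := galoisS s1KE galE.
rewrite [RHS](partition_big (@normalField_cast _ _ E K) (mem 'Gal(K / 1)%g));
  last first.
  by move=> s _; apply: mem_gal1.
apply: eq_bigr => f _.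
have : f \in (normalField_cast_morphism s1KE nK @* 'Gal(E / 1))%g.
  by rewrite (normalField_img galE s1KE nK) mem_gal1.
case/morphimP => s0 _ _ fE.
(* [s0] restricts to [f], so translation by it carries Gal(E/K) onto the fibre over [f]. *)
rewrite (reindex_inj (mulIg s0)) /=.
rewrite fE (normalField_cast_eq s1KE nK) ?mem_gal1 ?mem_galTrace // rmorph_sum.
apply: eq_big => [h|h _]; last by rewrite galM.
rewrite mem_gal1 /= (normalField_castM s1KE nK) ?mem_gal1 // -[X in _ ==
  X]mul1g.
rewrite (inj_eq (mulIg _)) -(normalField_ker s1KE nK).
apply/idP/eqP => [/mker//|h1]; apply/kerP => //; exact: mem_gal1.
Qed.

Lemma adjoin1_poly (w x : L) : x \in <<1; w>>%VS ->
  exists P : {poly rat}, x = (map_poly (in_alg L) P).[w].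
Proof. by case/Fadjoin_polyP => _ /polyOver1P[P ->] ->; exists P. Qed.

Lemma iota_horner (P : {poly rat}) x :
  iota (map_poly (in_alg L) P).[x] = (map_poly ratr P).[iota x].
Proof.
rewrite -horner_map -map_poly_comp; congr (_.[_]); apply: eq_map_poly => a /=.
by rewrite rmorphZ_num rmorph1 mulr1.
Qed.

End NumberFields.

(** * Cyclotomic fields of prime power conductor *)

Section Cyclotomic.
Variables (p r : nat) (L : splittingFieldType rat) (iota : {rmorphism L ->
  algC}).
Variable z : L.
Hypotheses (p_prime : prime p) (r_gt0 : (0 < r)%N).
Hypothesis z_prim : (p ^ r).-primitive_root z.

Local Notation N := (p ^ r)%N.
Local Notation n0 := (p ^ r.-1)%N.
Local Notation E := <<1; z>>%AS.
Implicit Types s t : gal_of E.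

Let N_gt0 : (0 < N)%N := prim_order_gt0 z_prim.
Let p_gt0 : (0 < p)%N := prime_gt0 p_prime.
Let n0_gt0 : (0 < n0)%N. Proof. by rewrite expn_gt0 p_gt0. Qed.
Let NE : N = (p * n0)%N. Proof. by rewrite -expnS prednK. Qed.

Lemma zX_mem i : z ^+ i \in E.
Proof. by rewrite rpredX // memv_adjoin. Qed.

Lemma zp_prim : n0.-primitive_root (z ^+ p).
Proof.
have n0_dvd : (n0 %| N)%N by rewrite NE dvdn_mull.
by have := dvdn_prim_root z_prim n0_dvd; rewrite {1}NE mulnK.
Qed.

Lemma zn0_prim : p.-primitive_root (z ^+ n0).
Proof.
have p_dvd : (p %| N)%N by rewrite NE dvdn_mulr.
by have := dvdn_prim_root z_prim p_dvd; rewrite NE mulKn.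
Qed.

Lemma galois_cyclotomic : galois 1 E.
Proof.
apply/splitting_galoisField; exists ('X^N - 1); split.
- by rewrite rpredB ?rpred1 // rpredX // polyOverX.
- rewrite -(factor_Xn_sub_1 z_prim).
  rewrite -(big_map (fun i => z ^+ i) xpredT (fun x => 'X - x%:P)).
  rewrite separable_prod_XsubC map_inj_in_uniq ?iota_uniq // => i j.
  rewrite !mem_index_iota => /andP[_ lti] /andP[_ ltj] /eqP.
  by rewrite (eq_prim_root_expr z_prim) !modn_small // => /eqP.
exists [seq z ^+ i | i <- index_iota 0 N].
  by rewrite big_map (factor_Xn_sub_1 z_prim) eqpxx.
apply/eqP; rewrite eqEsubv; apply/andP; split.
  apply/Fadjoin_seqP; split=> [|_ /mapP[i _ ->]]; [exact: sub1v|exact: zX_mem].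
apply/FadjoinP; split; first exact: sub1v.
apply: seqv_sub_adjoin; apply/mapP; exists (1 %% N)%N.
  by rewrite mem_index_iota ltn_mod N_gt0.
by rewrite (prim_expr_mod z_prim).
Qed.

Lemma gal_z_unity (s : gal_of E) : s z ^+ N = 1.
Proof. by rewrite -rmorphXn (prim_expr_order z_prim) rmorph1. Qed.

(** The cyclotomic character modulo N, by representatives below N; it is multiplicative only up to
    congruence. *)
Definition gexp (s : gal_of E) : 'I_N := sval (prim_rootP z_prim (gal_z_unity
  s)).

Lemma gexpE s : s z = z ^+ gexp s.
Proof. exact: svalP (prim_rootP z_prim (gal_z_unity s)). Qed.

Lemma gal_zX s i : s (z ^+ i) = z ^+ (gexp s * i).
Proof. by rewrite rmorphXn /= gexpE exprM. Qed.

Lemma coprime_gexp s : coprime (gexp s) p.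
Proof.
suff : coprime (gexp s) N by rewrite coprime_pexpr.
rewrite -(prim_root_exp_coprime _ z_prim) -gexpE.
by rewrite fmorph_primitive_root.
Qed.

Lemma gexp_gt0 s : (0 < gexp s)%N.
Proof.
case: posnP (coprime_gexp s) => // ->; rewrite /coprime gcd0n => /eqP p1.
by have := prime_gt1 p_prime; rewrite p1.
Qed.

Lemma gexpM s t : gexp (s * t)%g = (gexp s * gexp t)%N %[mod N].
Proof.
apply/eqP; rewrite -(eq_prim_root_expr z_prim) -gexpE galM ?memv_adjoin //.
by rewrite gexpE gal_zX mulnC.
Qed.

Lemma gexp1 : gexp 1%g = 1%N %[mod N].
Proof.
by apply/eqP; rewrite -(eq_prim_root_expr z_prim) -gexpE gal_id.
Qed.

Lemma gexpX s i : gexp (s ^+ i)%g = (gexp s ^ i)%N %[mod N].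
Proof.
elim: i => [|i IHi]; first by rewrite expg0 gexp1.
by rewrite expgS gexpM -modnMmr IHi modnMmr expnS.
Qed.

Lemma gexp_inj : injective gexp.
Proof.
move=> s t st; apply/eqP; rewrite gal_adjoin_eq ?mem_gal1 //.
by rewrite !gexpE st.
Qed.

Lemma gexp_eq1 s : gexp s = 1%N %[mod N] -> s = 1%g.
Proof.
move=> s1; apply/eqP; rewrite gal_adjoin_eq ?mem_gal1 // gal_id gexpE.
by rewrite -[X in _ == X]expr1 (eq_prim_root_expr z_prim); apply/eqP.
Qed.

(** The irreducibility of the cyclotomic polynomial enters here, through an automorphism of [algC]
    raising N-th roots of unity to the power [k], restricted to L and then to E. *)
Lemma gexp_surj k : coprime k p -> exists s : gal_of E, s z = z ^+ k.
Proof.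
move=> cop; have copN : coprime k N by rewrite coprime_pexpr.
have [nu nuE] := Qn_aut_exists copN.
have [f fE] := restrict_aut_to_normal_num_field iota nu.
have fz : f z = z ^+ k.
  apply: (fmorph_inj iota); rewrite fE nuE ?rmorphXn //.
  by rewrite -rmorphXn (prim_expr_order z_prim) rmorph1.
have homf : kHom 1 E (linfun f).
  apply/kHomP_tmp; split=> [_ /vlineP[a ->]|x y _ _]; rewrite !lfunE /=.
    by rewrite linearZ rmorph1.
  by rewrite rmorphM.
have [_ _ nE] := and3P galois_cyclotomic.
have s1EE : (1 <= E <= E)%VS by rewrite sub1v subvv.
have [s _ sE] := kHom_to_gal s1EE nE homf.
by exists s; rewrite -sE ?memv_adjoin // lfunE.
Qed.

Lemma imset_gexp : [set gexp s | s in 'Gal(E / 1)%g] = [set k : 'I_N | ~~ (p %|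
  k)%N].
Proof.
apply/setP => k; rewrite inE -prime_coprime // coprime_sym.
apply/imsetP/idP => [[s _ ->]|/gexp_surj[s sE]]; first exact: coprime_gexp.
exists s; rewrite ?mem_gal1 //; apply: val_inj; move/eqP: sE.
by rewrite gexpE (eq_prim_root_expr z_prim) !modn_small // => /eqP/esym.
Qed.

Lemma big_gexp (T : Type) (idx : T) (op : Monoid.com_law idx) (F : nat -> T) :
  \big[op/idx]_(s in 'Gal(E / 1)%g) F (gexp s) =
  \big[op/idx]_(k < N | ~~ (p %| k)%N) F k.
Proof.
rewrite -(big_imset (fun k : 'I_N => F k)) /=; last by move=> s t _ _ /gexp_inj.
by rewrite imset_gexp; apply: eq_bigl => k; rewrite inE.
Qed.

Lemma card_gal_cyclotomic : #|'Gal(E / 1)%g| = (n0 * p.-1)%N.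
Proof.
rewrite -(card_imset _ gexp_inj) imset_gexp.
have -> : #|[set k : 'I_N | ~~ (p %| k)%N]| = (N - n0)%N.
  rewrite -[N in RHS]card_ord -(cardsC [set k : 'I_N | ~~ (p %| k)%N]).
  rewrite -[LHS](addnK n0); congr (_ + _ - _)%N.
  rewrite -sum1_card (eq_bigl (fun k : 'I_N => (p %| k)%N)) => [|k].
    rewrite -(big_mkord (fun k => p %| k)%N (fun=> 1%N)) NE.
    by rewrite big_mkord (big_ord_dvdn _ _ (fun=> 1%N) p_gt0) sum1_card
      card_ord.
  by rewrite !inE negbK.
by rewrite NE -{2}[n0]mul1n -mulnBl subn1 mulnC.
Qed.

Lemma divzX u v : z ^+ u / z ^+ v = z ^+ (u + N.-1 * v).
Proof.
have zv_neq0 : z ^+ v != 0.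
  rewrite expf_neq0 //; apply/eqP => z0; have := prim_expr_order z_prim.
  by rewrite z0 expr0n -leqn0 leqNgt N_gt0 => /eqP; rewrite eq_sym oner_eq0.
apply: (mulIf zv_neq0); rewrite divfK // -exprD -addnA -mulSnr prednK //.
by rewrite exprD [z ^+ (N * v)]exprM (prim_expr_order z_prim) expr1n mulr1.
Qed.

Lemma dvd_divzX d u v : (d %| N)%N -> (d %| u + N.-1 * v)%N = (u == v %[mod d]).
Proof.
move=> dN; rewrite -(eqn_modDr (N.-1 * v)) -mulSn prednK //.
by rewrite [in RHS](eqP (dvdn_mulr v dN : _ == 0)%N).
Qed.

(** The trace of z^j sums z^(jk) over k prime to p: the sum over all k < N, minus that over the
    multiples of p, which is the full sum for the primitive n0-th root z^p. *)
Lemma galTrace_divz u v :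
  galTrace 1 E (z ^+ u / z ^+ v) =
  (if u == v %[mod N] then N%:R else 0) - (if u == v %[mod n0] then n0%:R else
    0).
Proof.
have n0N : (n0 %| N)%N by rewrite NE dvdn_mull.
rewrite divzX -!dvd_divzX //; set j := (u + _)%N.
rewrite /galTrace; under eq_bigr do rewrite gal_zX mulnC exprM.
rewrite (big_gexp _ (fun k => (z ^+ j) ^+ k)) /=.
apply/eqP; rewrite eq_sym subr_eq -(sum_prim_root_expr z_prim).
rewrite (bigID (fun k : 'I_N => (p %| k)%N)) /= addrC; apply/eqP; congr (_ + _).
rewrite -(big_mkord (fun k => p %| k)%N (fun k => (z ^+ j) ^+ k)) NE.
rewrite big_mkord (big_ord_dvdn _ _ (fun k => (z ^+ j) ^+ k)) //.
rewrite -(sum_prim_root_expr zp_prim); apply: eq_bigr => k _.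
by rewrite exprM [(z ^+ j) ^+ p]exprAC.
Qed.

(** * The ring of integers of Q(z) *)

Lemma natL_neq0 n : (0 < n)%N -> n%:R != 0 :> L.
Proof. by move=> n_gt0;
  rewrite -(fmorph_eq0 iota) rmorph_nat pnatr_eq0 -lt0n. Qed.

(** Fourier inversion: after exchanging sums, the coefficient of s x is the sum of (z / s z)^j over
    j < N, which is zero unless s = 1. *)
Lemma trace_expansion x : x \in E ->
  \sum_(j < N) galTrace 1 E (x / z ^+ j) * z ^+ j = N%:R * x.
Proof.
move=> Ex; rewrite /galTrace; under eq_bigr do rewrite mulr_suml.
rewrite exchange_big /=; transitivity
    (\sum_(s in 'Gal(E / 1)%g) s x * (if (gexp s == 1 %[mod N])%N then N%:R
      else 0)).
  apply: eq_bigr => s _; rewrite eq_sym -(dvd_divzX _ _ (dvdnn N)).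
  rewrite -(sum_prim_root_expr z_prim) mulr_sumr; apply: eq_bigr => j _.
  by rewrite rmorphM /= fmorphV /= -mulrA gal_zX exprM -divzX expr1 exprMn
    exprVn [_^-1 * _]mulrC.
rewrite (bigD1 1%g) ?group1 //= gexp1 eqxx gal_id mulrC big1 ?addr0 // => s.
move=> /andP[_ s_neq1]; case: eqP => [/gexp_eq1 s1|_]; last by rewrite mulr0.
by rewrite s1 eqxx in s_neq1.
Qed.

Definition zev : {poly int} -> L := horner_eval z \o map_poly intr.
HB.instance Definition _ := GRing.RMorphism.copy zev (horner_eval z \o map_poly
  intr).

Lemma zevX i : zev 'X^i = z ^+ i.
Proof. by rewrite /zev /= map_polyXn horner_evalE hornerXn. Qed.

Lemma zev_sum P : zev P = \sum_(i < size P) (P`_i)%:~R * z ^+ i.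
Proof.
rewrite /zev /= horner_evalE -{1}[P]coefK poly_def rmorph_sum horner_sum.
apply: eq_bigr => i _.
by rewrite /= map_polyZ /= map_polyXn hornerZ hornerXn.
Qed.

Lemma Aint_zev P : iota (zev P) \in Aint.
Proof.
rewrite zev_sum rmorph_sum rpred_sum // => i _.
rewrite rmorphM rmorph_int rmorphXn rpredM ?Aint_int // rpredX //.
by apply: (@Aint_prim_root N); rewrite fmorph_primitive_root.
Qed.

(** Both quotients are geometric sums, since z is in turn a power of z^k, with exponent [l] inverse
    to [k] modulo N by Euler. *)
Lemma one_sub_zX_assoc k : coprime k p ->
  exists P Q, 1 - z ^+ k = (1 - z) * zev P /\ 1 - z = (1 - z ^+ k) * zev Q.
Proof.
move=> cop; have dvd1X (x : L) n : 1 - x ^+ n = (1 - x) * \sum_(i < n) x ^+ i.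
  by rewrite -opprB subrX1 -mulNr opprB.
have copN : coprime k N by rewrite coprime_pexpr.
pose l := (k ^ (totient N).-1)%N.
have zkl : z ^+ k ^+ l = z.
  rewrite -exprM /l -expnS prednK ?totient_gt0 // -[RHS]expr1; apply/eqP.
  by rewrite (eq_prim_root_expr z_prim); apply/eqP/Euler_exp_totient.
exists (\sum_(i < k) 'X^i), (\sum_(i < l) 'X^(k * i)); split.
  by rewrite rmorph_sum dvd1X; congr (_ * _); apply: eq_bigr => i _;
    rewrite /= zevX.
rewrite -{1}zkl dvd1X; congr (_ * _); rewrite rmorph_sum.
by apply: eq_bigr => i _; rewrite /= zevX exprM.
Qed.

(** The product over all 0 < k < N is N; its factors with p dividing k form the same product for
    z^p, which is n0. [F] replaces the zero factor at k = 0 by 1. *)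
Lemma prod_one_sub_zX : \prod_(k < N | ~~ (p %| k)%N) (1 - z ^+ k) = p%:R.
Proof.
pose F k := if k == 0%N then 1 else 1 - z ^+ k.
have prodF n w : n.-primitive_root w -> \prod_(k < n) (if k == 0%N :> nat then
  1 else 1 - w ^+ k) = n%:R :> L.
  move=> w_prim; rewrite -(prod_1_sub_prim_root w_prim).
  rewrite -(big_mkord xpredT (fun k => if k == 0%N then 1 else 1 - w ^+ k)).
  rewrite big_ltn ?(prim_order_gt0 w_prim) //= mul1r !big_nat.
  by apply: eq_bigr => -[].
apply: (mulfI (natL_neq0 n0_gt0)); rewrite -natrM mulnC -NE -(prodF _ _ z_prim).
rewrite [RHS](bigID (fun k : 'I_N => (p %| k)%N)) /=; congr (_ * _); last first.
  by apply: eq_bigr => k pk; case: eqP pk => // ->; rewrite dvdn0.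
rewrite -(big_mkord (fun k => p %| k)%N F) NE.
rewrite big_mkord (big_ord_dvdn _ _ F) // -(prodF _ _ zp_prim).
apply: eq_bigr => k _; rewrite /F muln_eq0 -[p == 0%N]negbK -lt0n p_gt0 /=.
by rewrite exprM.
Qed.

Lemma p_assoc_one_sub_z : exists n P Q,
  p%:R = (1 - z) ^+ n * zev P /\ (1 - z) ^+ n = p%:R * zev Q.
Proof.
rewrite -prod_one_sub_zX -big_filter; set s := filter _ _.
have cop_s : all (fun k : 'I_N => coprime k p) s.
  by apply/allP => k; rewrite mem_filter -prime_coprime // coprime_sym =>
    /andP[].
exists (size s); elim: s cop_s => [_|k s IHs /= /andP[/one_sub_zX_assoc[P [Q
  [PE QE]]] /IHs]].
  by exists 1, 1; rewrite big_nil rmorph1 !mulr1.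
move=> [P' [Q' [PE' QE']]]; exists (P * P'), (Q * Q'); rewrite big_cons.
rewrite !rmorphM exprS; split; first by rewrite PE PE'; ring.
by rewrite QE' {1}QE; ring.
Qed.

(* In Z[z], p is associate to (1 - z)^n, and an integer divisible by 1 - z is
   divisible by p: so the (1 - z)-adic digits of an element of Z[z] that is
   divisible by p can be absorbed into p Z[z] one after the other. *)
Lemma zev_dvd_p_step P n Pn Qn i x :
    p%:R = (1 - z) ^+ n * zev Pn -> (1 - z) ^+ n = p%:R * zev Qn ->
    iota x \in Aint -> zev P = p%:R * x -> (i <= n)%N ->
  exists A B, zev P = p%:R * zev A + (1 - z) ^+ i * zev B.
Proof.
move=> PnE QnE Ax PE; have p_neq0 := natL_neq0 p_gt0.
have z1_neq0 : n != 0%N -> 1 - z != 0.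
  by move=> n_neq0; apply: contraNneq p_neq0 => z1;
    rewrite PnE z1 expr0n (negPf n_neq0) mul0r.
elim: i => [_|i IHi lt_in].
  by exists 0, P; rewrite rmorph0 mulr0 add0r mul1r.
have [A [B AB]] := IHi (ltnW lt_in).
have n_neq0 : n != 0%N by rewrite -lt0n (leq_ltn_trans _ lt_in).
have {}z1_neq0 := z1_neq0 n_neq0.
have [Q BE] : exists Q, B = (B.[1])%:P + Q * ('X - 1%:P).
  have : root (B - (B.[1])%:P) 1 by rewrite /root !hornerE subrr.
  by case/factor_theorem => Q QE; exists Q; rewrite -QE addrC subrK.
set m := B.[1] in BE.
have {}BE : zev B = m%:~R - (1 - z) * zev Q.
  have zevC : zev m%:P = m%:~R.
    by rewrite /zev /= map_polyC horner_evalE hornerC.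
  rewrite {1}BE rmorphD rmorphM rmorphB /= zevC -['X]/('X^1) zevX rmorph1; ring.
(* [y] is m / (1 - z): write p as (1 - z)^n times [zev Pn], cancel (1 - z)^i, and n - i - 1 factors
   are left besides the one split off. *)
pose y := (1 - z) ^+ (n - i.+1) * zev Pn * (x - zev A) + zev Q.
have my : m%:~R = (1 - z) * y.
  apply: (mulfI (expf_neq0 i z1_neq0)).
  have -> : (1 - z) ^+ i * m%:~R = zev P - p%:R * zev A + (1 - z) ^+ i * ((1 -
    z) * zev Q).
    by rewrite AB BE; ring.
  rewrite PE -mulrBr PnE -[in LHS](subnK lt_in) addnS exprS exprD /y; ring.
have Ay : iota y \in Aint.
  have A1z : iota (1 - z) \in Aint.
    by rewrite rmorphB rmorph1 rpredB ?rpred1 // -[z]expr1 -zevX Aint_zev.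
  by rewrite rmorphD !rmorphM rmorphXn rpredD ?rpredM ?rpredX ?Aint_zev //
    rmorphB rpredB ?Aint_zev.
(* m^n = (1 - z)^n y^n is p times an algebraic integer, which is rational and hence in Z. *)
have /dvdzP[m' mE] : (p %| m)%Z.
  pose w := zev Qn * y ^+ n.
  have Aw : iota w \in Aint by rewrite rmorphM rmorphXn rpredM ?rpredX
    ?Aint_zev.
  have mw : m%:~R ^+ n = p%:R * w by rewrite my exprMn QnE mulrA.
  have wE : w = in_alg L (m%:~R ^+ n / p%:R).
    apply: (mulfI p_neq0);
      rewrite -mw rmorphM fmorphV rmorphXn rmorph_int rmorph_nat.
    by rewrite mulrC mulfVK.
  have [k wk] : exists k : int, w = k%:~R.
    by apply: (mem1_Aint_int _ Aw); rewrite wE in_algE rpredZ ?mem1v.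
  have mk : m ^+ n = p%:Z * k.
    apply: (@intr_inj algC); rewrite rmorphXn rmorphM /= -!(rmorph_int iota).
    by rewrite -rmorphXn mw wk rmorphM !rmorph_int.
  have : (p %| m ^+ n)%Z by rewrite mk dvdz_mulr.
  by rewrite !dvdzE abszX Euclid_dvdX // lt0n n_neq0 andbT.
exists (A + (1 - 'X) ^+ i * m'%:P), (- Q).
have zevC : zev m'%:P = m'%:~R by rewrite /zev /= map_polyC horner_evalE
  hornerC.
rewrite AB BE mE intrM rmorphD rmorphM rmorphXn rmorphB rmorph1 /= -['X]/('X^1)
  zevX zevC rmorphN expr1 exprS /= -[p%:~R]pmulrn.
ring.
Qed.

Lemma zev_dvd_p P x : iota x \in Aint -> zev P = p%:R * x -> exists Q, x = zev
  Q.
Proof.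
have [n [Pn [Qn [PnE QnE]]]] := p_assoc_one_sub_z => Ax PE.
have [A [B AB]] := zev_dvd_p_step PnE QnE Ax PE (leqnn n).
exists (A + Qn * B); apply: (mulfI (natL_neq0 p_gt0)).
by rewrite -PE AB QnE rmorphD rmorphM /=; ring.
Qed.

(** The coefficients of [trace_expansion] are integers, so p^r x lies in Z[z]; the factors p are
    then removed one at a time. *)
Lemma cyclotomic_integers x : x \in E -> iota x \in Aint -> exists P, x = zev P.
Proof.
move=> Ex Ax.
have [P PE] : exists P, zev P = N%:R * x.
  have /fin_all_exists[m mE] (j : 'I_N) :
      exists m : int, galTrace 1 E (x / z ^+ j) = m%:~R.
    apply: (@galTrace_Aint_int _ iota _ _ galois_cyclotomic);
      first by rewrite rpred_div ?zX_mem.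
    have -> : x / z ^+ j = x * z ^+ (0 + N.-1 * j) by rewrite -divzX mul1r.
    by rewrite rmorphM rpredM // -zevX Aint_zev.
  exists (\sum_(j < N) (m j)%:~R * 'X^j);
    rewrite -(trace_expansion Ex) rmorph_sum.
  by apply: eq_bigr => j _; rewrite rmorphM /= rmorph_int zevX mE.
elim: (r) x {Ex} Ax P PE => [|k IHk] x Ax P; first by rewrite mul1r; exists P.
rewrite expnS natrM -mulrA => /zev_dvd_p[|Q QE]; last exact: IHk Ax _ (esym QE).
by rewrite rmorphM rmorph_nat rpredM // Aint_Cnat ?natr_nat.
Qed.

(** * Subfields of conductor p^r and their Galois groups *)

Section Subfield.
Variable K : {subfield L}.
Hypothesis p_odd : odd p.
Hypothesis galK : galois 1 K.
Hypothesis condK : has_conductor iota K N.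

Local Notation H := 'Gal(E / K)%g.

Lemma subfield_cyclotomic : (K <= E)%VS.
Proof.
have [[w w_prim wP] _] := condK; apply/subvP => x /wP[P xP].
have iz_prim : N.-primitive_root (iota z) by rewrite fmorph_primitive_root.
have [i wE] := prim_rootP iz_prim (prim_expr_order w_prim).
have -> : x = (map_poly (in_alg L) P).[z ^+ i].
  by apply: (fmorph_inj iota); rewrite iota_horner rmorphXn -wE.
apply: rpred_horner; last exact: zX_mem.
by apply/polyOverP => j; rewrite coef_map /= rpredZ ?mem1v.
Qed.

Let sKE := subfield_cyclotomic.
Let s1KE : (1 <= K <= E)%VS. Proof. by rewrite sub1v. Qed.
Let galKE : galois K E := galoisS s1KE galois_cyclotomic.

(* An element s of order p in H satisfies s z = w z with w a p-th root of unity
   fixed by s; averaging over <s> kills every z^j with p not dividing j, so K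
   would lie in Q(z^p), against the minimality of the conductor. *)
Lemma coprime_degree_p : coprime #|H| p.
Proof.
rewrite coprime_sym prime_coprime //; apply/negP => p_dvd.
have [s Hs s_order] := Cauchy p_prime p_dvd.
have gs_gt0 := gexp_gt0 s; set g := nat_of_ord (gexp s) in gs_gt0.
have gp : (g ^ p = 1 %[mod p ^ r.-1.+1])%N.
  have sp : (s ^+ p = 1)%g by rewrite -s_order expg_order.
  by rewrite prednK // -gexpX sp gexp1.
have p_g1 : (p %| g - 1)%N.
  by rewrite -eqn_mod_dvd //; apply/eqP; apply: eq1_mod_prime_of_expn gp.
have n0_g1 : (n0 %| g - 1)%N.
  by rewrite -eqn_mod_dvd //; apply/eqP; apply: eq1_mod_of_expn_prime gp.
pose w := z ^+ (g - 1).
have sz : s z = z * w by rewrite gexpE -exprS subn1 prednK.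
have wp : w ^+ p = 1.
  rewrite -exprM; apply/eqP; rewrite -(prim_order_dvd z_prim) NE.
  by rewrite [((g - 1) * p)%N]mulnC dvdn_pmul2l.
(* s w / w = z^((g - 1)^2), and (g - 1)^2 is divisible by p n0 = N. *)
have sw : s w = w.
  rewrite gal_zX -/g; apply/eqP; rewrite (eq_prim_root_expr z_prim).
  rewrite eqn_mod_dvd ?leq_pmull // -[X in (_ * _ - X)%N]mul1n -mulnBl NE.
  exact: dvdn_mul.
have w_neq1 : w != 1.
  apply/eqP => w1; move: s_order; rewrite (_ : s = 1%g).
    by rewrite order1 => p1; have := prime_gt1 p_prime; rewrite -p1.
  apply/eqP; rewrite gal_adjoin_eq ?mem_gal1 //.
  by rewrite gal_id sz w1 mulr1.
have w_prim : p.-primitive_root w.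
  have [m m_prim m_dvd] := prim_order_exists p_gt0 wp.
  case/primeP: p_prime => _ /(_ m m_dvd)/pred2P[m1|<- //].
  by move: w_neq1; rewrite -[w]expr1 -m1 (prim_expr_order m_prim) eqxx.
have siz i : (s ^+ i)%g z = z * w ^+ i.
  elim: i => [|i IHi]; first by rewrite expg0 gal_id mulr1.
  by rewrite expgSr galM ?memv_adjoin // IHi rmorphM rmorphXn /= sw sz -mulrA
    -exprS.
pose F : {subfield L} := <<1; z ^+ p>>%AS.
have subz : forall x, x \in K -> x \in F.
  move=> x Kx; have Ex := subvP sKE _ Kx.
  have [P xP] := adjoin1_poly Ex.
  have px : p%:R * x = \sum_(i < p) (s ^+ i)%g x.
    rewrite (eq_bigr (fun=> x)) ?sumr_const ?card_ord ?mulr_natl // => i _.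
    by rewrite (fixed_gal sKE) // groupX.
  suff : p%:R * x \in F.
    move=> Fpx; rewrite -[x](mulKf (natL_neq0 p_gt0)).
    by apply: rpredM Fpx; rewrite rpredV rpred_nat.
  rewrite px; have -> : \sum_(i < p) (s ^+ i)%g x =
      \sum_(j < size P) P`_j *: (z ^+ j * \sum_(i < p) (w ^+ j) ^+ i).
    under [RHS]eq_bigr do rewrite mulr_sumr scaler_sumr.
    rewrite exchange_big; apply: eq_bigr => i _.
    rewrite xP horner_coef size_map_poly rmorph_sum; apply: eq_bigr => j _.
    by rewrite coef_map /= mulr_algl linearZ rmorphXn /= siz exprMn exprAC.
  apply: rpred_sum => j _; rewrite (sum_prim_root_expr w_prim).
  case: ifP => [/dvdnP[k ->]|_]; last by rewrite mulr0 scaler0 rpred0.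
  by rewrite rpredZ // rpredM ?rpred_nat // mulnC exprM rpredX // memv_adjoin.
have [_ /(_ n0)] := condK; suff subn0 : sub_cyclotomic iota K n0.
  move/(_ subn0); rewrite leqNgt NE -{1}[n0]mul1n ltn_pmul2r //.
  by rewrite prime_gt1.
exists (iota (z ^+ p)); first by rewrite fmorph_primitive_root zp_prim.
move=> x /subz/adjoin1_poly[P ->]; exists P; exact: iota_horner.
Qed.

Lemma degree_dvd_p1 : (#|H| %| p.-1)%N.
Proof.
have := cardSg (galS E (sub1v K)); rewrite card_gal_cyclotomic Gauss_dvdr //.
by rewrite coprimeXr // coprime_degree_p.
Qed.

Lemma degree_dvd_n01 : (#|H| %| n0.-1)%N.
Proof. by rewrite predn_exp dvdn_mulr // degree_dvd_p1. Qed.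

(** Units that are 1 modulo p form a p-group modulo N, whereas [H] has order prime to p. *)
Lemma gexp_free s : s \in H -> gexp s = 1%N %[mod p] -> s = 1%g.
Proof.
move=> Hs s1; apply: gexp_eq1.
apply: (eq1_mod_of_expn p_prime (gexp_gt0 s) coprime_degree_p s1).
by rewrite -gexpX expg_cardG // gexp1.
Qed.

(** Applied with m = n0 and with m = p. If g c = c modulo p^k with c nonzero, then p divides g - 1,
    as otherwise g - 1 would be invertible; so [gexp_free] makes [H] act freely, even on residues
    divisible by p, and all orbits have #|H| elements. *)
Lemma transversal_exists m k n :
    m = (p ^ k)%N -> (k <= r)%N -> (n * #|H|)%N = m.-1 ->
  exists c : 'I_n -> nat,
  [/\ forall i, ~~ (m %| c i)%N,
      forall i j s, s \in H -> c i = (gexp s * c j)%N %[mod m] -> i = j /\ s =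
        1%g
    & forall a, ~~ (m %| a)%N -> exists2 s, s \in H &
        exists i, (gexp s * a)%N = c i %[mod m]].
Proof.
move=> mE le_kr nE; have m_gt0 : (0 < m)%N by rewrite mE expn_gt0 p_gt0.
have mN : (m %| N)%N by rewrite mE dvdn_exp2l.
pose act (c : 'I_m) s := Ordinal (ltn_pmod (gexp s * c) m_gt0).
have gexp1m : gexp 1%g = 1%N %[mod m] by rewrite -(modn_dvdm _ mN) gexp1
  modn_dvdm.
have gexpMm s t : gexp (s * t)%g = (gexp s * gexp t)%N %[mod m].
  by rewrite -(modn_dvdm _ mN) gexpM modn_dvdm.
have act1 : act^~ 1%g =1 id.
  by move=> c; apply: val_inj;
    rewrite /= -modnMml gexp1m modnMml mul1n modn_small.
have actM c : act_morph act c.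
  move=> s t; apply: val_inj; rewrite /= modnMmr -modnMml gexpMm modnMml.
  by rewrite mulnA [(gexp t * gexp s)%N]mulnC.
pose to := TotalAction act1 actM.
pose S := [set c : 'I_m | ~~ (m %| c)%N].
have gm s : coprime m (gexp s) by rewrite mE coprimeXl // coprime_sym
  coprime_gexp.
have actsS : [acts H, on S | to].
  apply/fintype.subsetP => s _; rewrite !inE; apply/fintype.subsetP => c;
    rewrite !inE /=.
  by rewrite /dvdn modn_mod -/(dvdn m (gexp s * c)) Gauss_dvdr.
have [Xtrans XS Xinj Xcover] := orbit_transversalP actsS.
set X := orbit_transversal to H S in Xtrans XS Xinj Xcover.
have free s (c : 'I_m) : s \in H -> c \in S -> to c s = c -> s = 1%g.
  rewrite inE => Hs mc /(congr1 val)/= /eqP;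
    rewrite -[X in _ == X](modn_small (ltn_ord c)).
  rewrite eqn_mod_dvd ?leq_pmull ?gexp_gt0 // -[X in (_ * _ - X)%N]mul1n
    -mulnBl => m_dvd.
  apply: (gexp_free Hs); apply/eqP; rewrite eqn_mod_dvd ?gexp_gt0 //.
  apply: contraNT mc; rewrite -prime_coprime // => cop.
  by move: m_dvd; rewrite Gauss_dvdr // mE coprimeXl.
have cardX : #|X| = n.
  apply/eqP; rewrite -(eqn_pmul2r (cardG_gt0 'Gal(E / K))) nE.
  have -> : m.-1 = #|S|.
    rewrite -[m in LHS]card_ord -(cardsC S).
    rewrite (_ : ~: S = [set Ordinal m_gt0]) ?cards1 ?addn1 //.
    apply/setP => c; rewrite !inE negbK; apply/idP/eqP => [|->];
      last by rewrite /= dvdn0.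
    by move=> mc; apply: val_inj => /=; apply/eqP; rewrite -leqn0 leqNgt;
      apply/negP => /(dvdn_leq)/(_ mc); rewrite leqNgt ltn_ord.
  rewrite (card_transversal Xtrans).
  suff orbE : {in [set orbit to H x | x in S], forall A : {set 'I_m}, #|A| =
    #|H|}.
    by rewrite (card_uniform_partition orbE (orbit_partition actsS)).
  move=> _ /imsetP[c Sc ->]; rewrite card_orbit.
  have -> : ('C_H[c | to] = 1)%g.
    apply/trivgP/fintype.subsetP => s; rewrite inE => /andP[Hs /astab1P cs].
    by rewrite inE; apply/eqP; apply: free cs.
  by rewrite indexg1.
pose c i : 'I_m := enum_val (cast_ord (esym cardX) i).
have cX i : c i \in X by apply: enum_valP.
exists (fun i => c i); split=> [i|i j s Hs cij|a ma].
- by have := fintype.subsetP XS _ (cX i); rewrite inE.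
- have toE : to (c j) s = c i by apply: val_inj; rewrite /= -cij modn_small.
  have : c i \in orbit to H (c j) by rewrite -toE mem_orbit.
  rewrite Xinj ?cX // => /eqP/enum_val_inj/cast_ord_inj ji; split=> //.
  by move: toE; rewrite ji; apply: free => //; apply: (fintype.subsetP XS).
have Sa : Ordinal (ltn_pmod a m_gt0) \in S by rewrite inE /= /dvdn modn_mod.
have [s Hs Xs] := Xcover _ Sa; exists s => //.
exists (cast_ord cardX (enum_rank_in Xs (to (Ordinal (ltn_pmod a m_gt0)) s))).
by rewrite /c cast_ordK enum_rankK_in //= modn_mod modnMmr.
Qed.

Local Notation T := (galTrace K E).

Lemma conj_fieldE x : iota (conj_field iota x) = (iota x)^*.
Proof. exact: svalP (restrict_aut_to_normal_num_field iota Num.conj) x. Qed.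

Lemma conj_zX v : conj_field iota (z ^+ v) = (z ^+ v)^-1.
Proof.
apply: (fmorph_inj iota); rewrite conj_fieldE fmorphV rmorphXn /=.
have iz1 : `|iota z| = 1.
  apply/eqP; rewrite -(pexpr_eq1 N_gt0 (normr_ge0 _)) -normrX.
  by rewrite -rmorphXn (prim_expr_order z_prim) rmorph1 normr1.
by rewrite invC_norm normrX iz1 !expr1n invr1 mul1r.
Qed.

Lemma conj_galTrace_zX v : conj_field iota (T (z ^+ v)) = T (z ^+ v)^-1.
Proof.
rewrite rmorph_sum; apply: eq_bigr => s _.
by rewrite /= gal_zX conj_zX fmorphV /= gal_zX.
Qed.

(** T is K-linear and the second factor lies in K, so it moves inside T; transitivity then reduces
    to traces from E. *)
Lemma galTrace_conj u v :
  galTrace 1 K (T (z ^+ u) * conj_field iota (T (z ^+ v))) =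
  \sum_(h in H) ((if u == (gexp h * v)%N %[mod N] then N%:R else 0) -
                 (if u == (gexp h * v)%N %[mod n0] then n0%:R else 0)).
Proof.
rewrite conj_galTrace_zX; set t := T _^-1.
have Kt : t \in K by rewrite mem_galTrace // rpredV zX_mem.
have -> : T (z ^+ u) * t = T (z ^+ u * t).
  rewrite mulr_suml; apply: eq_bigr => h Hh.
  by rewrite rmorphM /= (fixed_gal sKE Hh Kt).
rewrite galTrace_trans ?galois_cyclotomic ?rpredM ?zX_mem ?(subvP sKE) //.
rewrite mulr_sumr raddf_sum; apply: eq_bigr => h _ /=.
by rewrite fmorphV /= gal_zX galTrace_divz.
Qed.

(** * The relative traces: Gram matrix and generation of the ring of integers *)

Section Basis.
Variables m1 d : nat.
Variables (c1 : 'I_m1 -> nat) (c2 : 'I_d -> nat).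
Hypothesis c1_ndvd : forall i, ~~ (n0 %| c1 i)%N.
Hypothesis c1_inj : forall i j s,
  s \in H -> c1 i = (gexp s * c1 j)%N %[mod n0] -> i = j /\ s = 1%g.
Hypothesis c1_cover : forall a, ~~ (n0 %| a)%N ->
  exists2 s, s \in H & exists i, (gexp s * a)%N = c1 i %[mod n0].
Hypothesis c2_inj : forall i j s,
  s \in H -> c2 i = (gexp s * c2 j)%N %[mod p] -> i = j /\ s = 1%g.
Hypothesis c2_cover : forall a, ~~ (p %| a)%N ->
  exists2 s, s \in H & exists i, (gexp s * a)%N = c2 i %[mod p].

Local Notation I := ('I_m1 * 'I_p.-1 + 'I_d)%type.

Definition basis_exp (k : I) : nat :=
  match k with inl (i, l) => c1 i + n0 * l | inr i => n0 * c2 i end.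

(** The Gram matrices multiplied out over Z: N I - n0 J in each Gamma block, N I - e n0 J in the
    Lambda block, where p / e has disappeared. *)
Definition basis_gram (k k' : I) : int :=
  match k, k' with
  | inl ik, inl ik' =>
      if ik.1 == ik'.1 then (if ik.2 == ik'.2 then N%:Z else 0) - n0%:Z else 0
  | inr i, inr i' => (if i == i' then N%:Z else 0) - (#|H| * n0)%:Z
  | _, _ => 0
  end.

Let n0N : (n0 %| N)%N. Proof. by rewrite NE dvdn_mull. Qed.

Let modN_n0 a b : a = b %[mod N] -> a = b %[mod n0].
Proof. by move=> ab; rewrite -(modn_dvdm _ n0N) ab modn_dvdm. Qed.

Let modN_mul a b : (n0 * a == n0 * b %[mod N])%N = (a == b %[mod p]).
Proof. by rewrite NE [(p * n0)%N]mulnC -!muln_modr eqn_pmul2l. Qed.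

Let mod_n0D a b : (a + n0 * b = a %[mod n0])%N.
Proof. by rewrite mulnC addnC modnMDl. Qed.

Lemma galTrace_basis k k' :
  galTrace 1 K (T (z ^+ basis_exp k) * conj_field iota (T (z ^+ basis_exp k')))
    =
  (basis_gram k k')%:~R.
Proof.
rewrite galTrace_conj.
case: k k' => [[i l]|i] [[i' l']|i'] /=.
- have cond h : (c1 i + n0 * l == gexp h * (c1 i' + n0 * l') %[mod n0])%N
      = (c1 i == gexp h * c1 i' %[mod n0])%N.
    by rewrite mulnDr [(gexp h * (n0 * l'))%N]mulnCA !mod_n0D.
  (* Exponents that differ modulo n0 also differ modulo N, so both indicators vanish. *)
  have off h : h \in H -> ~ (i = i' /\ h = 1%g) ->
      (if (c1 i + n0 * l == gexp h * (c1 i' + n0 * l') %[mod N])%N then N%:R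
        else 0) -
      (if (c1 i + n0 * l == gexp h * (c1 i' + n0 * l') %[mod n0])%N then n0%:R
        else 0)
      = 0 :> L.
    move=> Hh nih; rewrite cond; case: eqP => [/modN_n0/eqP|_].
      by rewrite cond => /eqP/(c1_inj Hh).
    by case: eqP => [/(c1_inj Hh)//|_]; rewrite subr0.
  case: eqVneq => [ii'|nii']; last first.
    by rewrite big1 // => h Hh; apply: off => // -[ii' _];
      rewrite ii' eqxx in nii'.
  rewrite (bigD1 1%g) ?group1 //= [X in _ + X]big1 ?addr0 => [|h /andP[Hh
    nh1]]; last first.
    by apply: off => // -[_ h1]; rewrite h1 eqxx in nh1.
  rewrite cond -ii' -modnMml gexp1 modnMml mul1n eqn_modDl modN_mul.
  have /modN_n0 g1 := gexp1.
  rewrite -[((gexp 1%g * c1 i) %% n0)%N]modnMml g1 modnMml mul1n eqxx.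
  rewrite !modn_small ?(leq_trans (ltn_ord _)) ?leq_pred // -val_eqE.
  by rewrite rmorphB /=; case: ifP => _; rewrite ?pmulrn.
(* One exponent is nonzero modulo n0 and the other is zero, and multiplying by a unit keeps this:
   the two parts are orthogonal. *)
- rewrite big1 // => h Hh.
  have nc : (c1 i + n0 * l == gexp h * (n0 * c2 i') %[mod n0])%N = false.
    apply/negP; rewrite [(gexp h * _)%N]mulnCA modnMr => /eqP c0;
      have /negP[] := c1_ndvd i.
    by rewrite /dvdn -(mod_n0D _ l) c0.
  by rewrite nc; case: eqP => [/modN_n0/eqP|]; rewrite ?nc ?subr0.
- rewrite big1 // => h Hh.
  have nc : (n0 * c2 i == gexp h * (c1 i' + n0 * l') %[mod n0])%N = false.
    apply/negP; rewrite modnMr mulnDr [(gexp h * (n0 * l'))%N]mulnCA mod_n0D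
      eq_sym => /eqP c0.
    have /negP[] := c1_ndvd i'.
    rewrite -(@Gauss_dvdr _ (gexp h)) ?/dvdn ?c0 //.
    by rewrite coprimeXl // coprime_sym coprime_gexp.
  by rewrite nc; case: eqP => [/modN_n0/eqP|]; rewrite ?nc ?subr0.
(* All exponents are zero modulo n0, so every h in [H] contributes n0: this is where the factor e of
   the Lambda block comes from. *)
rewrite sumrB rmorphB /=; congr (_ - _); last first.
  rewrite (eq_bigr (fun=> n0%:R)) => [|h _];
    last by rewrite mulnCA !modnMr eqxx.
  by rewrite sumr_const -mulrnA mulnC pmulrn.
have cond h : (n0 * c2 i == gexp h * (n0 * c2 i') %[mod N])%N
    = (c2 i == gexp h * c2 i' %[mod p])%N by rewrite mulnCA modN_mul.
under eq_bigr do rewrite cond.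
have off h : h \in H -> ~ (i = i' /\ h = 1%g) ->
    (if (c2 i == gexp h * c2 i' %[mod p])%N then N%:R else 0) = 0 :> L.
  by move=> Hh nih; case: eqP => // /(c2_inj Hh).
case: eqVneq => [ii'|nii']; last first.
  by rewrite big1 // => h Hh; apply: off => // -[ii' _];
    rewrite ii' eqxx in nii'.
rewrite (bigD1 1%g) ?group1 //= big1 ?addr0 => [|h /andP[Hh nh1]]; last first.
  by apply: off => // -[_ h1]; rewrite h1 eqxx in nh1.
have pN : (p %| N)%N by rewrite NE dvdn_mulr.
have g1 : gexp 1%g = 1%N %[mod p] by rewrite -(modn_dvdm _ pN) gexp1 modn_dvdm.
by rewrite -ii' -[((gexp 1%g * c2 i) %% p)%N]modnMml g1 modnMml mul1n eqxx
  -pmulrn.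
Qed.

Definition basis_comb (c : I -> int) : L := \sum_k T (z ^+ basis_exp k) *~ c k.

Lemma Aint_z : iota z \in Aint.
Proof. by rewrite -[z]expr1 -zevX Aint_zev. Qed.

Lemma mem_basis_comb c : basis_comb c \in K.
Proof.
by apply: rpred_sum => k _; rewrite rpredMz // mem_galTrace ?zX_mem.
Qed.

Lemma Aint_basis_comb c : iota (basis_comb c) \in Aint.
Proof.
rewrite rmorph_sum rpred_sum // => k _; rewrite rmorphMz rpredMz //.
by apply: Aint_galTrace; rewrite rmorphXn rpredX ?Aint_z.
Qed.

Lemma mem_conj_basis_comb c : conj_field iota (basis_comb c) \in K.
Proof.
rewrite rmorph_sum rpred_sum // => k _; rewrite rmorphMz rpredMz //=.
by rewrite conj_galTrace_zX mem_galTrace // rpredV zX_mem.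
Qed.

Lemma galTrace_basis_comb c c' :
  galTrace 1 K (basis_comb c * conj_field iota (basis_comb c')) =
  (\sum_k \sum_k' c k * c' k' * basis_gram k k')%:~R.
Proof.
rewrite {1}/basis_comb mulr_suml raddf_sum [RHS]rmorph_sum.
apply: eq_bigr => k _ /=; rewrite /basis_comb rmorph_sum mulr_sumr.
rewrite raddf_sum [RHS]rmorph_sum; apply: eq_bigr => k' _ /=.
rewrite rmorphMz /= !mulrzAl !mulrzAr !raddfMz /= galTrace_basis.
by rewrite -!mulrzA; congr (_ *~ _); ring.
Qed.

Lemma basis_combD c c' : basis_comb c + basis_comb c' = basis_comb (fun k => c
  k + c' k).
Proof. by rewrite -big_split; apply: eq_bigr => k _; rewrite mulrzDr. Qed.

Lemma basis_combMz c m : basis_comb c *~ m = basis_comb (fun k => c k * m).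
Proof. by rewrite mulrz_suml; apply: eq_bigr => k _; rewrite mulrzA. Qed.

Lemma basis_comb_sum (J : finType) (P : pred J) (y : J -> L) :
    (forall j, P j -> exists c, y j = basis_comb c) ->
  exists c, \sum_(j | P j) y j = basis_comb c.
Proof.
move=> yP; elim/big_rec: _ => [|j x Pj [c ->]].
  by exists (fun=> 0); rewrite /basis_comb big1 // => k _; rewrite mulr0z.
by have [c' ->] := yP j Pj; exists (fun k => c' k + c k); rewrite basis_combD.
Qed.

Lemma basis_comb_delta k : exists c, T (z ^+ basis_exp k) = basis_comb c.
Proof.
exists (fun k' => (k' == k)%:Z); rewrite /basis_comb (bigD1 k) //= eqxx.
by rewrite mulr1z big1 ?addr0 // => k' /negPf->; rewrite mulr0z.
Qed.

Lemma basis_combN y : (exists c, y = basis_comb c) -> exists c, - y =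
  basis_comb c.
Proof. by case=> c ->; exists (fun k => c k * -1);
  rewrite -basis_combMz mulrNz. Qed.

Lemma basis_comb_galTrace j : exists c, T (z ^+ j) = basis_comb c.
Proof.
have sum_zn0 : \sum_(k < p) (z ^+ n0) ^+ k = 0.
  have := sum_prim_root_expr zn0_prim 1; rewrite expr1 => ->.
  by rewrite dvdn1 -[_ == _]negbK neq_ltn prime_gt1 ?orbT.
have sum_pred (F : nat -> L) : \sum_(k < p) F k = \sum_(k < p.-1) F k + F p.-1.
  by rewrite -(big_mkord xpredT F) -{1}(prednK p_gt0) big_nat_recr //=
    big_mkord.
have TH s a b : s \in H -> (gexp s * a = b %[mod N])%N -> T (z ^+ a) = T (z ^+
  b).
  move=> Hs ab; rewrite -(galTrace_gal (zX_mem a) Hs) gal_zX; congr (T _).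
  by apply/eqP; rewrite (eq_prim_root_expr z_prim); apply/eqP.
have [/dvdnP[a ->{j}]|nj] := boolP (n0 %| j)%N; last first.
  have [s Hs [i si]] := c1_cover nj.
  have [l [lt_lp jE]] : exists l, (l < p)%N /\ (gexp s * j = c1 i + n0 * l
    %[mod N])%N.
    (* Adding N c1 i changes nothing modulo N and keeps the natural-number subtraction from
       truncating. *)
    have c_le : (c1 i <= gexp s * j + N * c1 i)%N.
      by rewrite (leq_trans _ (leq_addl _ _)) // leq_pmull.
    pose y := (gexp s * j + N * c1 i - c1 i)%N.
    have /dvdnP[q yE] : (n0 %| y)%N.
      rewrite -eqn_mod_dvd //; apply/eqP.
      by rewrite -modnDmr (eqP (dvdn_mulr _ n0N)) addn0 si.
    exists (q %% p)%N; split; first by rewrite ltn_mod.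
    rewrite muln_modr [(n0 * p)%N]mulnC -NE modnDmr [(n0 * q)%N]mulnC.
    by rewrite -yE /y subnKC // [(N * _)%N]mulnC addnC modnMDl.
  rewrite (TH s _ _ Hs jE); have [lt_lp1|] := ltnP l p.-1.
    exact: (basis_comb_delta (inl (i, Ordinal lt_lp1))).
  move=> le_pl; have -> : l = p.-1.
    by apply/eqP; rewrite eqn_leq le_pl andbT -ltnS prednK.
  (* The omitted index l = p - 1 is recovered from the vanishing sum of the p-th roots of unity,
     multiplied by z^(c1 i). *)
  have -> : T (z ^+ (c1 i + n0 * p.-1)) = - \sum_(k < p.-1) T (z ^+ (c1 i + n0
    * k)).
    apply/eqP; rewrite -addr_eq0 addrC -(sum_pred (fun k => T (z ^+ (c1 i + n0
      * k)))).
    rewrite -raddf_sum /=; under eq_bigr do rewrite exprD exprM.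
    by rewrite -mulr_sumr sum_zn0 mulr0 raddf0.
  apply: basis_combN; apply: basis_comb_sum => k _.
  exact: (basis_comb_delta (inl (i, k))).
have unitcase b : ~~ (p %| b)%N -> exists c, T (z ^+ (b * n0)) = basis_comb c.
  move=> nb; have [s Hs [i si]] := c2_cover nb.
  rewrite (TH s _ (n0 * c2 i)%N Hs); first exact: (basis_comb_delta (inr i)).
  by apply/eqP; rewrite mulnA mulnC modN_mul; apply/eqP.
have [/dvdnP[b ->]|/unitcase//] := boolP (p %| a)%N.
(* Here the power of z is 1, which is minus the sum of the nontrivial p-th roots of unity. *)
have -> : T (z ^+ (b * p * n0)) = - \sum_(k < p | k != 0%N :> nat) T (z ^+ (k *
  n0)).
  have -> : z ^+ (b * p * n0) = 1.
    by rewrite -mulnA -NE mulnC exprM (prim_expr_order z_prim) expr1n.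
  rewrite -raddf_sum -raddfN /=; congr (T _); apply/eqP; rewrite -addr_eq0.
  rewrite -[X in _ == X]sum_zn0 [X in _ == X](bigD1 (Ordinal p_gt0)) //= expr0.
  apply/eqP; congr (_ + _); apply: eq_big => [k|k _]; first by rewrite -val_eqE.
  by rewrite mulnC exprM.
apply: basis_combN; apply: basis_comb_sum => k k_neq0; apply: unitcase.
by rewrite gtnNdvd // lt0n.
Qed.

(* As e x = T x lies in the span, it suffices that its coordinates are divisible
   by e; they are, because the Gram matrix is invertible modulo e. *)
Lemma basis_comb_surj x : x \in K -> iota x \in Aint ->
  exists c, x = basis_comb c.
Proof.
move=> Kx Ax; have Ex := subvP sKE _ Kx.
have Tx : T x = #|H|%:R * x.
  rewrite /galTrace (eq_bigr (fun=> x)) ?sumr_const ?mulr_natl // => h Hh.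
  by rewrite (fixed_gal sKE Hh Kx).
have [c cE] : exists c, #|H|%:R * x = basis_comb c.
  rewrite -Tx; have [P ->] := cyclotomic_integers Ex Ax.
  rewrite zev_sum raddf_sum; apply: basis_comb_sum => j _ /=.
  have [c cE] := basis_comb_galTrace j; exists (fun k => c k * P`_j).
  by rewrite -basis_combMz -cE mulrC -raddfMz /= mulrzr.
have e_gt0 : (0 < #|H|)%N := cardG_gt0 _.
(* Pairing e x with an integral y gives e times the trace of x times the conjugate of y, and that
   trace is an integer. *)
have gram_dvd c' : (#|H| %| \sum_k \sum_k' c k * c' k' * basis_gram k k')%Z.
  set y := conj_field iota (basis_comb c').
  have Ay : iota (x * y) \in Aint.
    by rewrite rmorphM rpredM // conj_fieldE Aint_aut Aint_basis_comb.
  have [m mE] := galTrace_Aint_int galK (rpredM Kx (mem_conj_basis_comb c')) Ay.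
  apply/dvdzP; exists m; apply: (@intr_inj algC).
  rewrite -(rmorph_int iota) -galTrace_basis_comb -cE -mulrA mulr_natl raddfMn
    /=.
  by rewrite mE rmorphMn rmorph_int intrM -mulr_natr pmulrn.
have gram_col k0 : (#|H| %| \sum_k c k * basis_gram k k0)%Z.
  have := gram_dvd (fun k => (k == k0)%:Z); congr (_ %| _)%Z;
    apply: eq_bigr => k _.
  rewrite (bigD1 k0) //= eqxx mulr1 big1 ?addr0 // => k' /negPf->.
  by rewrite mulr0 mul0r.
have p1_dvd : (#|H| %| p%:Z - 1)%Z.
  by rewrite -[X in _ - X]/(1%:Z) subzn // dvdzE /= subn1 degree_dvd_p1.
have coprime_p : coprimez #|H| p%:Z := coprime_degree_p.
have coprime_n0 : coprimez #|H| n0%:Z := coprimeXr r.-1 coprime_degree_p.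
have c_dvd k : (#|H| %| c k)%Z.
  (* Modulo e the Lambda block is N I, and N is a unit modulo e. *)
  case: k => [[i l]|i]; last first.
    have := gram_col (inr i); rewrite big_sumType /= big1 ?add0r => [|k _];
      last first.
      by rewrite mulr0.
    have -> : \sum_i' c (inr i') * ((if i' == i then N%:Z else 0) - (#|H| *
      n0)%:Z) =
        n0%:Z * (p%:Z * c (inr i)) - #|H|%:Z * (n0%:Z * \sum_i' c (inr i')).
      rewrite (eq_bigr (fun i' => c (inr i') * (if i' == i then N%:Z else 0)
        - c (inr i') * (#|H| * n0)%:Z)) => [|i' _]; last by rewrite mulrBr.
      rewrite sumrB -mulr_suml (bigD1 i) //= eqxx big1 ?addr0 => [|i' /negPf->].
        by rewrite NE !PoszM; ring.
      by rewrite mulr0.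
    by rewrite (dvdzBr _ (dvdz_mulr _ (dvdzz _))) !Gauss_dvdzr.
  (* Column l' of a Gamma block gives n0 (p c_l' - S); since p = 1 modulo e, this says c_l' = S
     modulo e. Summing over the p - 1 = 0 modulo e indices shows that e divides S, hence each
     c_l'. *)
  pose S := \sum_l' c (inl (i, l')).
  have cS l' : (#|H| %| c (inl (i, l')) - S)%Z.
    have := gram_col (inl (i, l'));
      rewrite big_sumType /= [X in _ + X]big1 => [|k _]; last first.
      by rewrite mulr0.
    have -> : \sum_(k : 'I_m1 * 'I_p.-1) c (inl k) * (if k.1 == i then
        (if k.2 == l' then N%:Z else 0) - n0%:Z else 0) =
        n0%:Z * ((p%:Z - 1) * c (inl (i, l')) + (c (inl (i, l')) - S)).
      transitivity (\sum_i' \sum_l1 c (inl (i', l1)) * (if i' == i then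
        (if l1 == l' then N%:Z else 0) - n0%:Z else 0)).
        by rewrite pair_bigA; apply: eq_bigr => -[].
      rewrite (bigD1 i) //= [X in _ + X]big1 ?addr0 => [|i' /negPf->];
        last first.
        by rewrite big1 // => l1 _; rewrite mulr0.
      rewrite eqxx (eq_bigr (fun l1 => c (inl (i, l1)) * (if l1 == l' then N%:Z
        else 0)
        - c (inl (i, l1)) * n0%:Z)) => [|l1 _]; last by rewrite mulrBr.
      rewrite sumrB -mulr_suml -/S (bigD1 l') //= eqxx big1 ?addr0 => [|l1
        /negPf->].
        by rewrite NE !PoszM; ring.
      by rewrite mulr0.
    by rewrite addr0 Gauss_dvdzr // (dvdzDl _ (dvdz_mulr _ p1_dvd)).
  have S_dvd : (#|H| %| S)%Z.
    have : (#|H| %| \sum_l' (c (inl (i, l')) - S))%Z by apply: rpred_sum => l'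
      _; apply: cS.
    rewrite sumrB sumr_const card_ord -/S -[S *+ _]mulr_natl natz dvdzBr //.
    by rewrite dvdz_mulr // dvdzE /= degree_dvd_p1.
  by have := cS l; rewrite dvdzBr.
have [u uE] : exists u : I -> int, forall k, c k = u k * #|H|%:Z.
  by exists (fun k => (c k %/ #|H|)%Z) => k; rewrite divzK.
exists u; apply: (mulfI (natL_neq0 e_gt0)); rewrite cE /basis_comb mulr_sumr.
by apply: eq_bigr => k _; rewrite uE mulrzA -mulrzr mulrC.
Qed.

(** * The isometry with the orthogonal sum *)

Section Isometry.
Variable R : realType.
Hypothesis dE : (d * #|H|)%N = p.-1.

Local Notation Gamma := (gram_lattice (Gamma_block R p r)).
Local Notation Lambda := (gram_lattice (Lambda_gram R p r #|H| d)).
Local Notation M := (orth_sum (orth_copies m1 Gamma) Lambda).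

Definition coords (x : M) (k : I) : int :=
  match k with inl (i, l) => x.1 i 0 l | inr i => x.2 0 i end.

Lemma form_coords (x y : M) :
  fm_form x y =
  (\sum_k \sum_k' coords x k * coords y k' * basis_gram k k')%:~R.
Proof.
transitivity (\sum_i fm_form (x.1 i : Gamma) (y.1 i) + fm_form (x.2 : Lambda)
  y.2);
  first by [].
rewrite big_sumType intrD; congr (_ + _).
  transitivity (\sum_i \sum_l \sum_l' (x.1 i 0 l * y.1 i 0 l' *
      ((if l == l' then N%:Z else 0) - n0%:Z))%:~R : R).
    apply: eq_bigr => i _; rewrite gram_lattice_form; apply: eq_bigr => l _.
    apply: eq_bigr => l' _; rewrite !intrM intrB !mxE; congr (_ * _).
    case: eqVneq => _; rewrite ?mulr1n ?mulr0n -!pmulrn.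
      by rewrite NE natrM natrX; ring.
    by rewrite natrX sub0r; ring.
  rewrite pair_bigA rmorph_sum; apply: eq_bigr => -[i l] _ /=.
  rewrite big_sumType /= [X in _ + X]big1 ?addr0 => [|k _];
    last by rewrite mulr0.
  transitivity (\sum_i' \sum_l' (x.1 i 0 l * y.1 i' 0 l' * (if i == i' then
      (if l == l' then N%:Z else 0) - n0%:Z else 0))%:~R : R).
    rewrite (bigD1 i) //= eqxx [X in _ + X]big1 ?addr0 // => i' nii'.
    by rewrite big1 // => l' _; rewrite [i == i']eq_sym (negPf nii') mulr0.
  by rewrite pair_bigA rmorph_sum; apply: eq_bigr => -[].
rewrite gram_lattice_form rmorph_sum; apply: eq_bigr => i _ /=.
rewrite big_sumType /= [X in (X + _)%:~R]big1 ?add0r => [|[j l] _];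
  last by rewrite mulr0.
rewrite rmorph_sum; apply: eq_bigr => i' _ /=.
have e_neq0 : #|H|%:R != 0 :> R by rewrite pnatr_eq0 -lt0n cardG_gt0.
rewrite !intrM intrB !mxE; congr (_ * _).
case: eqVneq => _; rewrite ?mulr1n ?mulr0n -!pmulrn.
  by rewrite NE !natrM natrX; field.
by rewrite natrM natrX sub0r; ring.
Qed.

Lemma Gamma_lattice_on : lattice_on 'I_p.-1 Gamma.
Proof.
apply: gram_lattice_on; first by rewrite exprn_gt0 // ltr0n.
by rewrite ltr_nat prednK.
Qed.

Lemma Lambda_lattice_on : lattice_on 'I_d Lambda.
Proof.
have e_gt0 : 0 < #|H|%:R :> R by rewrite ltr0n cardG_gt0.
apply: gram_lattice_on; first by rewrite mulr_gt0 // exprn_gt0 // ltr0n.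
by rewrite ltr_pdivlMr // -natrM ltr_nat dE prednK.
Qed.

Lemma orth_sum_lattice : lattice_on I M.
Proof.
apply: orth_sum_lattice_on; last exact: Lambda_lattice_on.
exact: orth_copies_lattice_on Gamma_lattice_on.
Qed.

(** Surjectivity is [basis_comb_surj]; for injectivity, a kernel element would have form value 0 in
    a positive definite lattice. *)
Lemma isometric_trace_lattice : isometric M (trace_lattice iota K R).
Proof.
have fint x : basis_comb (coords x) \in int_pred iota K.
  by rewrite unfold_in mem_basis_comb Aint_basis_comb.
pose f (x : M) : trace_lattice iota K R := RingOfIntegers (fint x).
have fB : zmod_morphism f.
  move=> x y; apply: val_inj; rewrite raddfB /= /basis_comb -sumrB.
  by apply: eq_bigr => -[[i l]|i] _; rewrite -mulrzBr /= ?ffunE !mxE.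
pose F : {additive M -> trace_lattice iota K R} :=
  HB.pack f (GRing.isZmodMorphism.Build _ _ f fB).
have fP x y : fm_form (f x) (f y) = fm_form x y.
  have tr := galTrace_basis_comb (coords x) (coords y).
  rewrite form_coords /= (trace_fieldP (a := (\sum_k \sum_k' coords x k *
    coords y k' * basis_gram k k')%:~R)) ?ratr_int // tr.
  by rewrite scaler_int.
exists F => //.
have f_surj y : exists x, f x = y.
  have /andP[Ky Ay] := valP y.
  have [c yE] := basis_comb_surj Ky Ay.
  exists ([ffun i => \row_l c (inl (i, l))], \row_i c (inr i)).
  apply: val_inj; rewrite yE /=; apply: eq_bigr => -[[i l]|i] _ /=.
    by rewrite ffunE mxE.
  by rewrite mxE.
have f_inj : injective f.
  move=> x y fxy; apply/eqP; rewrite -subr_eq0; apply/idPn => xy.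
  have := lattice_on_form_gt0 orth_sum_lattice xy; rewrite -fP.
  have -> : f (x - y) = 0 by rewrite fB fxy subrr.
  by rewrite /= mul0r /trace_field raddf0 linear0 raddf0 ltxx.
have [g gK] := boolp.choice f_surj.
by exists g => // x; apply: f_inj.
Qed.

End Isometry.

End Basis.

(** Multiplied by e, the left side is (n0 - 1)(p - 1) + (p - 1) = n0 (p - 1), the degree of E. *)
Lemma dim_subfield m1 d : (m1 * #|H|)%N = n0.-1 -> (d * #|H|)%N = p.-1 ->
  (m1 * p.-1 + d)%N = \dim K.
Proof.
move=> m1E dE; apply/eqP; rewrite -(eqn_pmul2r (cardG_gt0 'Gal(E / K))).
have dimE : \dim E = (\dim K * #|H|)%N.
  by rewrite -(galois_dim galKE) mulnC -(dim_sup_field sKE).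
have := galois_dim galois_cyclotomic; rewrite dimv1 divn1 card_gal_cyclotomic.
rewrite dimE => ->; rewrite mulnDl dE mulnAC m1E.
by rewrite -mulSnr prednK.
Qed.

Lemma trace_lattice_decomposition (R : realType) m1 d :
    (m1 * #|H|)%N = n0.-1 -> (d * #|H|)%N = p.-1 ->
  isometric (trace_lattice iota K R)
    (orth_sum (orth_copies m1 (gram_lattice (Gamma_block R p r)))
       (gram_lattice (Lambda_gram R p r #|H| d))).
Proof.
move=> m1E dE; apply: isometric_sym.
have [c1 [c1n c1i c1c]] := transversal_exists (erefl n0) (leq_pred r) m1E.
have [c2 [_ c2i c2c]] := transversal_exists (esym (expn1 p)) r_gt0 dE.
exact: (isometric_trace_lattice c1n c1i c1c c2i c2c).
Qed.

End Subfield.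
End Cyclotomic.

Theorem theorem6p1 (R : realType) (p r : nat)
    (L : splittingFieldType rat) (iota : {rmorphism L -> algC})
    (z : L) (K : {subfield L})
    (p_prime : prime p) (p_odd : odd p) (r_ge1 : (1 <= r)%N)
    (z_prim : (p ^ r).-primitive_root z)
    (K_abelian : abelian_field K)
    (K_conductor : has_conductor iota K (p ^ r)) :
  let e := (\dim_K <<1; z>>%VS)%N in
  let d := (p.-1 %/ e)%N in
  [/\ (* the quotients and the field degree are exact *)
      [/\ (K <= <<1; z>>)%VS, (e %| p.-1)%N & (e %| p ^ r.-1 - 1)%N],
      (* the form modules involved are lattices of the stated ranks *)
      [/\ is_lattice (\dim K) (trace_lattice iota K R),
          is_lattice p.-1 (gram_lattice (Gamma_block R p r))
        & is_lattice d (Lambda_lattice R p r e d)],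
      isometric (trace_lattice iota K R)
        (orth_sum (Gamma_lattice R p r e) (Lambda_lattice R p r e d))
    & isometric (gram_lattice (Gamma_block R p r))
        (scale_form (p%:R ^+ r)
           (dual_lattice (root_lattice_A R p.-1)))].
Proof.
have [galK _] := K_abelian.
have p_gt0 := prime_gt0 p_prime.
have sKE : (K <= <<1; z>>)%VS := subfield_cyclotomic z_prim K_conductor.
have s1KE : (1 <= K <= <<1; z>>)%VS by rewrite sub1v.
have galKE := galoisS s1KE (galois_cyclotomic z_prim).
move=> e d; rewrite /d /e {d e} (galois_dim galKE).
have e_p1 := degree_dvd_p1 p_prime r_ge1 z_prim p_odd K_conductor.
have e_n0 := degree_dvd_n01 p_prime r_ge1 z_prim p_odd K_conductor.
rewrite -subn1 in e_n0.
set e := #|_| in e_p1 e_n0 *; set d := (p.-1 %/ e)%N.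
pose m1 := ((p ^ r.-1 - 1) %/ e)%N.
have m1E : (m1 * e)%N = (p ^ r.-1).-1 by rewrite -subn1 divnK.
have dE : (d * e)%N = p.-1 by rewrite divnK.
have iso : isometric (trace_lattice iota K R)
    (orth_sum (Gamma_lattice R p r e) (Lambda_lattice R p r e d)).
  exact: (trace_lattice_decomposition p_prime r_ge1 z_prim p_odd galK
    K_conductor R m1E dE).
split=> //.
- split.
  + apply: lattice_on_is_lattice; last first.
      exact: isometric_lattice_on iso (orth_sum_lattice r p_prime m1 R dE).
    rewrite card_sum card_prod !card_ord.
    exact: (dim_subfield p_prime r_ge1 z_prim K_conductor m1E dE).
  + exact: lattice_on_is_lattice (card_ord _) (Gamma_lattice_on r p_prime R).
  + exact: lattice_on_is_lattice (card_ord _)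
      (Lambda_lattice_on r p_prime R dE).
have := gram_isometric_dual_A p.-1 (p%:R ^+ r.-1 : R).
have p1 : p.-1.+1%:R = p%:R :> R by rewrite prednK.
by rewrite p1 -exprSr (prednK r_ge1).
Qed.
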